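(* Let $\mathcal E_*$ be a pointed model category, $\mathcal J$ a pointed weak lattice, $\widetilde Y:\mathcal J\to\operatorname{ho}(\mathcal E_* )$ a pointed functor, and $x\in\operatorname{Obj}\mathcal J$ with $|x|>n\ge k\ge2$. Let $\widetilde Y^x_k:\mathcal J^x_k\to\operatorname{ho}(\mathcal E_* )$ be the restriction of $\widetilde Y$, let $Y_k:\partial\mathcal J^x_k\to\mathcal E_*$ be a pointed Reedy fibrant functor lifting $\widetilde Y^x_k|_{\partial\mathcal J^x_k}$, and let $Y^x_{k-1}:\mathcal J^x_{k-1}\to\mathcal E_*$ be a pointed functor lifting $\widetilde Y^x_k|_{\mathcal J^x_{k-1}}$ which agrees with $Y_k$ on $\partial\mathcal J^x_{k-1}$. Then there exists a pointed functor $Y^x_k:\mathcal J^x_k\to\mathcal E_*$ lifting $\widetilde Y^x_k$ and strictly extending $Y_k$ and $Y^x_{k-1}$ if and only if the total pointed higher homotopy operation $\langle Y^x_{k-1}\rangle$ vanishes.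
   Context: **Weak lattices.** A weak lattice is a connected Reedy indexing category $\mathcal J$ with finite Hom-sets and a degree function $|\cdot|:\operatorname{Obj}\mathcal J\to\mathbb N$ such that there are finitely many objects in each degree, all non-identity morphisms strictly decrease degree, and every object maps to at least one object of degree $0$. For $x\in\operatorname{Obj}\mathcal J$, $\mathcal J^x$ is the full subcategory on the objects $t$ with $\mathcal J(x,t)\ne\emptyset$. For $k<|x|$, $\mathcal J^x_k$ is the full subcategory of $\mathcal J^x$ on $x$ and all its objects of degree $\le k$, and $\partial\mathcal J^x_k$ is its full subcategory on all objects other than $x$. **Pointed notions.** $\mathcal E_*$ is the category of objects of a model category under the terminal object $*$, with the inherited model structure; $*$ also denotes zero maps. $\mathcal J$ is pointed if its morphisms are partitioned, $\mathcal J(x,t)=\widetilde{\mathcal J}(x,t)\sqcup\overline{\mathcal J}(x,t)$, so that $\mathrm{Id}_x\in\overline{\mathcal J}(x,x)$ iff $x$ is a zero object of $\mathcal J$, and any composite $f\circ g$ with $f$ or $g$ in $\overline{\mathcal J}$ lies in $\overline{\mathcal J}$. A functor on $\mathcal J$ (or on a full subcategory) to $\mathcal E_*$ or $\operatorname{ho}(\mathcal E_* )$ is pointed if it sends every morphism in $\overline{\mathcal J}$ to the zero map. **Reduced matching objects.** For $Y$ pointed on $\partial\mathcal J^x_k$, $\mathbf M^x_k$ is the limit of $(f:x\to s)\mapsto Y(s)$ over the category of morphisms in $\mathcal J$ from $x$ to objects of degree $\le k$ (morphisms: commuting triangles under $x$), and $\overline{\mathbf M}^x_k$ is the pullback of $\mathbf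 M^x_k\to\prod_{|t|\le k}\prod_{\mathcal J(x,t)}Y(t)$ (inclusion of the limit) along the section $\Theta:\prod_{|t|\le k}\prod_{\widetilde{\mathcal J}(x,t)}Y(t)\to\prod_{|t|\le k}\prod_{\mathcal J(x,t)}Y(t)$ which is zero on the factors indexed by $\overline{\mathcal J}$; the projection $\overline{\mathbf M}^x_k\to\prod_{|t|\le k}\prod_{\widetilde{\mathcal J}(x,t)}Y(t)$ is denoted $\overline{\operatorname{forget}}$. If $Y$ is a pointed functor on $\mathcal J^x_k$, $\overline{\operatorname m}^x_k:Y(x)\to\overline{\mathbf M}^x_k$ is the canonical map. $Y$ is pointed Reedy fibrant if each $\overline{\operatorname m}^s_{|s|-1}$ is a fibration (for $|s|=0$: $Y(s)$ is fibrant). **Conventions.** A functor into $\mathcal E_*$ lifts a functor into $\operatorname{ho}(\mathcal E_* )$ if it has the given composite with $\mathcal E_*\to\operatorname{ho}(\mathcal E_* )$. All objects $\widetilde Y(s)$ are fibrant and cofibrant; in particular $Y(x):=Y^x_{k-1}(x)$ is cofibrant; $\sim$ denotes (pointed) homotopy. $Y(t)$ denotes the common value of the given functors. **The data.** $\sigma^x_{<k}:Y(x)\to\prod_{|t|<k}\prod_{\widetilde{\mathcal J}(x,t)}Y(t)$ has components $Y^x_{k-1}(f)$; $\sigma^x_k:Y(x)\to\prod_{|s|=k}\prod_{\widetilde{\mathcal J}(x,s)}Y(s)$ is a fixed map whose component at $g$ represents $\widetilde Y^x_k(g)$. The map $\overline\Psi:\prod_{|t|<k}\prod_{\widetilde{\mathcal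 J}(x,t)}Y(t)\to\prod_{|s|=k}\prod_{\widetilde{\mathcal J}(x,s)}\prod_{|v|<k}\prod_{\widetilde{\mathcal J}(s,v)}Y(v)$ has component at $(g:x\to s,f:s\to v)$ the projection onto the factor indexed by $f\circ g$ if $f\circ g\in\widetilde{\mathcal J}$, and the zero map otherwise. Let $$\prod_{|s|=k}\prod_{\widetilde{\mathcal J}(x,s)}Y(s)\xrightarrow{\ \alpha\ }\prod_{|s|=k}\prod_{\widetilde{\mathcal J}(x,s)}\overline{\mathbf M}^s_{k-1}\xrightarrow{\ \beta\ }\prod_{|s|=k}\prod_{\widetilde{\mathcal J}(x,s)}\prod_{|v|<k}\prod_{\widetilde{\mathcal J}(s,v)}Y(v)$$ be the products of the maps $\overline{\operatorname m}^s_{k-1}$ and $\overline{\operatorname{forget}}$. Let $\overline{\mathbf Q}^x_{k-1}$ be the pullback of $\overline\Psi$ and $\beta$, and let $\eta_{k-1}:Y(x)\to\overline{\mathbf Q}^x_{k-1}$ be induced by $\sigma^x_{<k}$ and by the maps $Y(x)\to\overline{\mathbf M}^s_{k-1}$ (for $g\in\widetilde{\mathcal J}(x,s)$, $|s|=k$) with components $Y^x_{k-1}(f\circ g)$. **The operation.** Factor $\overline\Psi=\overline\Psi'\circ\iota$ with $\iota$ a weak equivalence (acyclic cofibration) into $F^1$ and $\overline\Psi'$ a fibration. Let $F^2$ be the pullback of $\overline\Psi'$ and $\beta$, with projection $q:F^2\to F^1$ and induced map $\gamma:\overline{\mathbf Q}^x_{k-1}\to F^2$. The total pointed higher homotopy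 operation $\langle Y^x_{k-1}\rangle$ is the set of homotopy classes of maps $\theta:Y(x)\to F^2$ with $\overline\Psi'\circ q\circ\theta=\beta\circ\alpha\circ\sigma^x_k$ and $q\circ\theta\sim\iota\circ\sigma^x_{<k}$. It vanishes if it contains the class $[\gamma\circ\eta_{k-1}]$. *)

(* Defs.v *)
From Stdlib Require Import Bool List Arith Lia FinFun Relation_Operators.
From Stdlib Require Import Classical ClassicalEpsilon.
From Stdlib Require Import FunctionalExtensionality PropExtensionality ProofIrrelevance.
From Corelib Require Import ssreflect ssrfun ssrbool.

Set Implicit Arguments.
Unset Strict Implicit.
Unset Printing Implicit Defensive.

#[local] Obligation Tactic := idtac.

Lemma sig_ext (A : Type) (P : A -> Prop) (u v : {a | P a}) :
  proj1_sig u = proj1_sig v -> u = v.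
Proof. by apply: eq_sig_hprop => ? ? ?; apply: proof_irrelevance. Qed.

Record Category := MkCategory {
  Obj :> Type;
  Hom : Obj -> Obj -> Type;
  idm : forall x, Hom x x;
  comp : forall x y z, Hom y z -> Hom x y -> Hom x z;
  comp_idl : forall x y (f : Hom x y), comp (idm y) f = f;
  comp_idr : forall x y (f : Hom x y), comp f (idm x) = f;
  comp_assoc : forall w x y z (h : Hom y z) (g : Hom x y) (f : Hom w x),
    comp h (comp g f) = comp (comp h g) f
}.
Arguments Hom {_} _ _.
Arguments idm {_} _.
Arguments comp {_ _ _ _} _ _.
Arguments comp_idl {_ _ _} _.
Arguments comp_idr {_ _ _} _.
Arguments comp_assoc {_ _ _ _ _} _ _ _.

Declare Scope cat_scope.
Delimit Scope cat_scope with cat.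
Notation "g ∘ f" := (comp g f) (at level 40, left associativity) : cat_scope.
Local Open Scope cat_scope.

Record Functor (C D : Category) := MkFunctor {
  fobj :> C -> D;
  fmap : forall x y, Hom x y -> Hom (fobj x) (fobj y);
  fmap_id : forall x, fmap (idm x) = idm (fobj x);
  fmap_comp : forall x y z (g : Hom y z) (f : Hom x y),
    fmap (g ∘ f) = fmap g ∘ fmap f
}.
Arguments fmap {_ _} _ {_ _} _.

Program Definition fcompose (C D E : Category) (G : Functor D E) (F : Functor C D) :
    Functor C E :=
  @MkFunctor C E (fun x => G (F x)) (fun x y f => fmap G (fmap F f)) _ _.
Next Obligation. by move=> C D E G F x /=; rewrite !fmap_id. Qed.
Next Obligation. by move=> C D E G F x y z g f /=; rewrite !fmap_comp. Qed.

Program Definition Full (C : Category) (P : C -> Prop) : Category :=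
  @MkCategory {x : C | P x} (fun x y => Hom (proj1_sig x) (proj1_sig y))
    (fun x => idm (proj1_sig x)) (fun x y z g f => comp g f) _ _ _.
Next Obligation. by move=> *; apply: comp_idl. Qed.
Next Obligation. by move=> *; apply: comp_idr. Qed.
Next Obligation. by move=> *; apply: comp_assoc. Qed.

Program Definition restrict (C D : Category) (F : Functor C D) (P : C -> Prop) :
    Functor (Full P) D :=
  @MkFunctor (Full P) D (fun x => F (proj1_sig x)) (fun x y f => fmap F f) _ _.
Next Obligation. by move=> *; apply: fmap_id. Qed.
Next Obligation. by move=> *; apply: fmap_comp. Qed.

Inductive is_identity (C : Category) : forall x y : C, Hom x y -> Prop :=
| IsIdentity x : is_identity (idm x).

Record ZeroObject (C : Category) := MkZero {
  zero_obj :> C;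
  to_zero : forall x, Hom x zero_obj;
  from_zero : forall x, Hom zero_obj x;
  to_zero_unique : forall x (f : Hom x zero_obj), f = to_zero x;
  from_zero_unique : forall x (f : Hom zero_obj x), f = from_zero x
}.

Definition zero_map (C : Category) (Z : ZeroObject C) (x y : C) : Hom x y :=
  from_zero Z y ∘ to_zero Z x.

Definition is_zero_object (C : Category) (z : C) : Prop :=
  exists Z : ZeroObject C, zero_obj Z = z.

Lemma comp_zero_l (C : Category) (Z : ZeroObject C) (x y z : C) (f : Hom x y) :
  zero_map Z y z ∘ f = zero_map Z x z.
Proof. by rewrite /zero_map -comp_assoc (to_zero_unique (_ ∘ f)). Qed.

Lemma comp_zero_r (C : Category) (Z : ZeroObject C) (x y z : C) (f : Hom y z) :
  f ∘ zero_map Z x y = zero_map Z x z.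
Proof. by rewrite /zero_map comp_assoc (from_zero_unique (f ∘ _)). Qed.

Record Limit (I C : Category) (F : Functor I C) := MkLimit {
  lim :> C;
  lim_proj : forall i, Hom lim (F i);
  lim_cone : forall i j (u : Hom i j), fmap F u ∘ lim_proj i = lim_proj j;
  lim_map : forall (X : C) (c : forall i, Hom X (F i)),
    (forall i j (u : Hom i j), fmap F u ∘ c i = c j) -> Hom X lim;
  lim_map_proj : forall X c H i, lim_proj i ∘ @lim_map X c H = c i;
  lim_ext : forall (X : C) (f g : Hom X lim),
    (forall i, lim_proj i ∘ f = lim_proj i ∘ g) -> f = g
}.

Record Colimit (I C : Category) (F : Functor I C) := MkColimit {
  colim :> C;
  colim_inj : forall i, Hom (F i) colim;
  colim_cocone : forall i j (u : Hom i j), colim_inj j ∘ fmap F u = colim_inj i;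
  colim_map : forall (X : C) (c : forall i, Hom (F i) X),
    (forall i j (u : Hom i j), c j ∘ fmap F u = c i) -> Hom colim X;
  colim_map_inj : forall X c H i, @colim_map X c H ∘ colim_inj i = c i;
  colim_ext : forall (X : C) (f g : Hom colim X),
    (forall i, f ∘ colim_inj i = g ∘ colim_inj i) -> f = g
}.

Arguments lim_map {_ _ _} _ {X c} _.
Arguments lim_map_proj {_ _ _} _ {X c} _ _.
Arguments lim_ext {_ _ _} _ {X f g} _.
Arguments colim_map {_ _ _} _ {X c} _.
Arguments colim_map_inj {_ _ _} _ {X c} _ _.
Arguments colim_ext {_ _ _} _ {X f g} _.

Definition finite_category (I : Category) : Prop :=
  Finite I /\ forall i j : I, Finite (Hom i j).

Definition is_retract (C : Category) (a b x y : C) (f : Hom a b) (g : Hom x y) : Prop :=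
  exists (i : Hom a x) (r : Hom x a) (j : Hom b y) (s : Hom y b),
    r ∘ i = idm a /\ s ∘ j = idm b /\ g ∘ i = j ∘ f /\ f ∘ r = s ∘ g.

(** Quillen's axioms CM1-CM5 for a closed model category, with chosen finite
    limits and colimits. *)
Record ModelCategory := MkModel {
  mcat :> Category;
  Weq : forall x y : mcat, Hom x y -> Prop;
  Fib : forall x y : mcat, Hom x y -> Prop;
  Cof : forall x y : mcat, Hom x y -> Prop;
  mc_lim : forall (I : Category) (F : Functor I mcat), finite_category I -> Limit F;
  mc_colim : forall (I : Category) (F : Functor I mcat), finite_category I -> Colimit F;
  mc_two_of_three : forall (x y z : mcat) (g : Hom y z) (f : Hom x y),
    (Weq f -> Weq g -> Weq (g ∘ f)) /\
    (Weq f -> Weq (g ∘ f) -> Weq g) /\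
    (Weq g -> Weq (g ∘ f) -> Weq f);
  mc_retract : forall (a b x y : mcat) (f : Hom a b) (g : Hom x y), is_retract f g ->
    (Weq g -> Weq f) /\ (Fib g -> Fib f) /\ (Cof g -> Cof f);
  mc_lift : forall (a b x y : mcat) (i : Hom a b) (p : Hom x y),
    Cof i -> Fib p -> Weq i \/ Weq p ->
    forall (u : Hom a x) (v : Hom b y), p ∘ u = v ∘ i ->
    exists h : Hom b x, h ∘ i = u /\ p ∘ h = v;
  mc_factor_weq_cof : forall (x y : mcat) (f : Hom x y),
    exists (z : mcat) (i : Hom x z) (p : Hom z y),
      Cof i /\ Weq i /\ Fib p /\ p ∘ i = f;
  mc_factor_weq_fib : forall (x y : mcat) (f : Hom x y),
    exists (z : mcat) (i : Hom x z) (p : Hom z y),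
      Cof i /\ Fib p /\ Weq p /\ p ∘ i = f
}.
Arguments Weq {_ _ _} _.
Arguments Fib {_ _ _} _.
Arguments Cof {_ _ _} _.
Arguments mc_lim {_ _} _ _.
Arguments mc_colim {_ _} _ _.

Program Definition Discrete (A : Type) : Category :=
  @MkCategory A (fun a b => a = b) (fun a => eq_refl)
    (fun a b c (q : b = c) (p : a = b) => eq_trans p q) _ _ _.
Next Obligation. by move=> A a b /= e; destruct e. Qed.
Next Obligation. by move=> A a b /= e; destruct e. Qed.
Next Obligation. by move=> A a b c d /= e1 e2 e3; destruct e1, e2, e3. Qed.

Program Definition discrete_functor (A : Type) (C : Category) (Y : A -> C) :
    Functor (Discrete A) C :=
  @MkFunctor (Discrete A) C Y
    (fun a b (e : a = b) => match e in _ = b' return Hom (Y a) (Y b') with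
                            | eq_refl => idm (Y a) end) _ _.
Next Obligation. by []. Qed.
Next Obligation. by move=> A C Y a b c /= g f; destruct g, f; rewrite comp_idl. Qed.

Lemma discrete_finite (A : Type) : Finite A -> finite_category (Discrete A).
Proof.
move=> finA; split=> // a b.
case: (classic (a = b)) => [e|ne]; last by exists nil.
by exists (e :: nil) => e'; left; exact: (proof_irrelevance (a = b)).
Qed.

Section Products.
Context (M : ModelCategory) (A : Type) (finA : Finite A) (Y : A -> M).

Definition product : Limit (discrete_functor Y) :=
  mc_lim (discrete_functor Y) (discrete_finite finA).

Definition proj (a : A) : Hom product (Y a) := lim_proj product a.

Lemma product_cone (X : M) (c : forall a, Hom X (Y a)) (i j : Discrete A) (u : Hom i j) :
  fmap (discrete_functor Y) u ∘ c i = c j.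
Proof. by case: j / u => /=; rewrite comp_idl. Qed.

Definition tuple (X : M) (c : forall a, Hom X (Y a)) : Hom X product :=
  lim_map product (product_cone c).

Lemma proj_tuple (X : M) (c : forall a, Hom X (Y a)) (a : A) : proj a ∘ tuple c = c a.
Proof. exact: (lim_map_proj product). Qed.

Lemma product_ext (X : M) (f g : Hom X product) :
  (forall a, proj a ∘ f = proj a ∘ g) -> f = g.
Proof. exact: (lim_ext product). Qed.

End Products.

Definition product_map (M : ModelCategory) (A : Type) (finA : Finite A) (Y Y' : A -> M)
    (f : forall a, Hom (Y a) (Y' a)) : Hom (product finA Y) (product finA Y') :=
  tuple finA (fun a => f a ∘ proj finA Y a).

Lemma finite_empty : Finite Empty_set.
Proof. by exists nil; case. Qed.

Definition terminal (M : ModelCategory) : M :=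
  product finite_empty (fun e : Empty_set => match e return M with end).

Definition to_terminal (M : ModelCategory) (x : M) : Hom x (terminal M) :=
  tuple finite_empty
    (fun e : Empty_set => match e return Hom x (match e return M with end) with end).

Lemma to_terminal_unique (M : ModelCategory) (x : M) (f g : Hom x (terminal M)) : f = g.
Proof. by apply: product_ext; case. Qed.

Inductive cospan_obj := CoLeft | CoRight | CoVertex.

Definition cospan_hom (i j : cospan_obj) : Set :=
  match i, j with
  | CoLeft, CoLeft | CoRight, CoRight | CoVertex, CoVertex
  | CoLeft, CoVertex | CoRight, CoVertex => unit
  | _, _ => Empty_set
  end.

Program Definition Cospan : Category :=
  @MkCategory cospan_obj cospan_hom
    (fun i => match i return cospan_hom i i with CoLeft | CoRight | CoVertex => tt end)
    _ _ _ _.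
Next Obligation. by case; case; case=> //= [] [] []. Defined.
Next Obligation. by case; case; case. Qed.
Next Obligation. by case; case; case. Qed.
Next Obligation. by case; case; case; case=> //= [] [] [] []. Qed.

Lemma cospan_finite : finite_category Cospan.
Proof.
split; first by exists (CoLeft :: CoRight :: CoVertex :: nil); case=> /=; tauto.
case=> [] []; first [by exists (tt :: nil); case; left | by exists nil; case].
Qed.

Section Pullback.
Context (M : ModelCategory) (a b c : M) (f : Hom a c) (g : Hom b c).

Definition cospan_fobj (i : Cospan) : M :=
  match i with CoLeft => a | CoRight => b | CoVertex => c end.

Definition cospan_fmap (i j : Cospan) : Hom i j -> Hom (cospan_fobj i) (cospan_fobj j) :=
  match i, j return cospan_hom i j -> Hom (cospan_fobj i) (cospan_fobj j) with
  | CoLeft, CoLeft => fun _ => idm a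
  | CoRight, CoRight => fun _ => idm b
  | CoVertex, CoVertex => fun _ => idm c
  | CoLeft, CoVertex => fun _ => f
  | CoRight, CoVertex => fun _ => g
  | _, _ => fun e => match e with end
  end.

Program Definition cospan_functor : Functor Cospan M :=
  @MkFunctor Cospan M cospan_fobj cospan_fmap _ _.
Next Obligation. by case. Qed.
Next Obligation.
by case; case; case=> //= [] [] [] /=; rewrite ?comp_idl ?comp_idr.
Qed.

Definition pullback : Limit cospan_functor := mc_lim cospan_functor cospan_finite.

Definition pb_fst : Hom pullback a := lim_proj pullback CoLeft.
Definition pb_snd : Hom pullback b := lim_proj pullback CoRight.

Lemma pb_square : f ∘ pb_fst = g ∘ pb_snd.
Proof.
rewrite /pb_fst /pb_snd.
have /= -> := lim_cone pullback (i := CoLeft) (j := CoVertex) tt.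
by have /= -> := lim_cone pullback (i := CoRight) (j := CoVertex) tt.
Qed.

Section Pair.
Context (X : M) (u : Hom X a) (v : Hom X b) (uv : f ∘ u = g ∘ v).

Definition pb_cone (i : Cospan) : Hom X (cospan_functor i) :=
  match i return Hom X (cospan_fobj i) with
  | CoLeft => u | CoRight => v | CoVertex => f ∘ u
  end.

Lemma pb_cone_comm (i j : Cospan) (h : Hom i j) :
  fmap cospan_functor h ∘ pb_cone i = pb_cone j.
Proof. by case: i j h; case=> //= h; rewrite ?comp_idl ?uv //; case: h. Qed.

Definition pb_pair : Hom X pullback := lim_map pullback pb_cone_comm.

Lemma pb_fst_pair : pb_fst ∘ pb_pair = u.
Proof. exact: (lim_map_proj pullback pb_cone_comm CoLeft). Qed.

Lemma pb_snd_pair : pb_snd ∘ pb_pair = v.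
Proof. exact: (lim_map_proj pullback pb_cone_comm CoRight). Qed.
End Pair.

Lemma pb_ext (X : M) (u v : Hom X pullback) :
  pb_fst ∘ u = pb_fst ∘ v -> pb_snd ∘ u = pb_snd ∘ v -> u = v.
Proof.
move=> e1 e2; apply: (lim_ext pullback); case=> //.
have e := lim_cone pullback (i := CoLeft) (j := CoVertex) tt.
by rewrite -e -!comp_assoc; congr (_ ∘ _).
Qed.
End Pullback.

Section Pointed.
Context (E : ModelCategory).

Record PtObj := MkPtObj { pt_obj : E; pt_base : Hom (terminal E) pt_obj }.

Definition PtHom (X Y : PtObj) : Type :=
  {f : Hom (pt_obj X) (pt_obj Y) | f ∘ pt_base X = pt_base Y}.

Definition pt_id (X : PtObj) : PtHom X X := exist _ (idm (pt_obj X)) (comp_idl _).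

Program Definition pt_comp (X Y Z : PtObj) (g : PtHom Y Z) (f : PtHom X Y) : PtHom X Z :=
  exist _ (proj1_sig g ∘ proj1_sig f) _.
Next Obligation. by move=> X Y Z [g Hg] [f Hf] /=; rewrite -comp_assoc Hf. Qed.

Program Definition PtCat : Category := @MkCategory PtObj PtHom pt_id pt_comp _ _ _.
Next Obligation. by move=> *; apply: sig_ext; apply: comp_idl. Qed.
Next Obligation. by move=> *; apply: sig_ext; apply: comp_idr. Qed.
Next Obligation. by move=> *; apply: sig_ext; apply: comp_assoc. Qed.

Program Definition pt_forget : Functor PtCat E :=
  @MkFunctor PtCat E pt_obj (fun X Y f => proj1_sig f) _ _.
Next Obligation. by []. Qed.
Next Obligation. by []. Qed.

Program Definition pt_zero : ZeroObject PtCat :=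
  @MkZero PtCat (@MkPtObj (terminal E) (idm _))
    (fun X => exist _ (to_terminal (pt_obj X)) _)
    (fun X => exist _ (pt_base X) _) _ _.
Next Obligation. by move=> *; apply: to_terminal_unique. Qed.
Next Obligation. by move=> *; apply: comp_idr. Qed.
Next Obligation. by move=> *; apply: sig_ext; apply: to_terminal_unique. Qed.
Next Obligation. by move=> X [f Hf]; apply: sig_ext; rewrite /= -Hf /= comp_idr. Qed.

Section PtLimit.
Context (I : Category) (F : Functor I PtCat) (finI : finite_category I).

Let L : Limit (fcompose pt_forget F) := mc_lim (fcompose pt_forget F) finI.

Lemma pt_lim_base_cone (i j : I) (u : Hom i j) :
  fmap (fcompose pt_forget F) u ∘ pt_base (F i) = pt_base (F j).
Proof. exact: (proj2_sig (fmap F u)). Qed.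

Definition pt_lim_obj : PtObj := MkPtObj (lim_map L pt_lim_base_cone).

Lemma pt_lim_map_cone (X : PtCat) (c : forall i, Hom X (F i))
    (H : forall i j (u : Hom i j), fmap F u ∘ c i = c j) (i j : I) (u : Hom i j) :
  fmap (fcompose pt_forget F) u ∘ proj1_sig (c i) = proj1_sig (c j).
Proof. by rewrite -(H i j u). Qed.

Program Definition pt_limit : Limit F :=
  @MkLimit I PtCat F pt_lim_obj
    (fun i => exist _ (lim_proj L i) _) _
    (fun X c H => exist _ (lim_map L (pt_lim_map_cone H)) _) _ _.
Next Obligation. by move=> i /=; rewrite lim_map_proj. Qed.
Next Obligation. by move=> i j u; apply: sig_ext; apply: (lim_cone L). Qed.
Next Obligation.
move=> X c H /=; apply: (lim_ext L) => i.
by rewrite comp_assoc !lim_map_proj; exact: (proj2_sig (c i)).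
Qed.
Next Obligation. by move=> X c H i; apply: sig_ext; rewrite /= lim_map_proj. Qed.
Next Obligation.
move=> X f g H; apply: sig_ext; apply: (lim_ext L) => i.
exact: (f_equal (@proj1_sig _ _) (H i)).
Qed.
End PtLimit.

(** Colimits of pointed diagrams are computed by adding the terminal object of
    [E], with all the base points, to the underlying diagram. *)
Section PtColimit.
Context (I : Category) (F : Functor I PtCat) (finI : finite_category I).

Definition cone_hom (i j : option I) : Type :=
  match i, j with
  | None, _ => unit
  | Some a, Some b => Hom a b
  | Some _, None => Empty_set
  end.

Definition cone_id (i : option I) : cone_hom i i :=
  match i with None => tt | Some a => idm a end.

Definition cone_comp (i j k : option I) : cone_hom j k -> cone_hom i j -> cone_hom i k :=
  match i, j, k return cone_hom j k -> cone_hom i j -> cone_hom i k with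
  | None, _, _ => fun _ _ => tt
  | Some a, Some b, Some c => fun g f => comp g f
  | Some a, None, _ => fun _ f => match f with end
  | Some a, Some b, None => fun g _ => match g with end
  end.

Program Definition ConeCat : Category :=
  @MkCategory (option I) cone_hom cone_id cone_comp _ _ _.
Next Obligation. by case=> [a|] [b|] /= f; first [apply: comp_idl | case: f]. Qed.
Next Obligation. by case=> [a|] [b|] /= f; first [apply: comp_idr | case: f]. Qed.
Next Obligation. by case=> [a|] [b|] [c|] [d|] /= h g f; first [apply: comp_assoc | case: f | case: g | case: h]. Qed.

Lemma cone_finite : finite_category ConeCat.
Proof.
case: finI => -[l Hl] Hh; split.
  exists (None :: List.map Some l); case=> [a|] /=; last by left.
  by right; apply: in_map.
by case=> [a|] [b|]; first [exact: Hh | by exists (tt :: nil); case; left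
  | by exists nil; case].
Qed.

Definition cone_fobj (i : ConeCat) : E :=
  match i with None => terminal E | Some a => pt_obj (F a) end.

Definition cone_fmap (i j : ConeCat) : Hom i j -> Hom (cone_fobj i) (cone_fobj j) :=
  match i, j return cone_hom i j -> Hom (cone_fobj i) (cone_fobj j) with
  | None, None => fun _ => idm (terminal E)
  | None, Some b => fun _ => pt_base (F b)
  | Some a, Some b => fun f => proj1_sig (fmap F f)
  | Some a, None => fun f => match f with end
  end.

Program Definition cone_functor : Functor ConeCat E :=
  @MkFunctor ConeCat E cone_fobj cone_fmap _ _.
Next Obligation. by case=> [a|] //=; rewrite fmap_id. Qed.
Next Obligation.
case=> [a|] [b|] [c|] //= g f; rewrite ?comp_idr ?comp_idl //.
  by rewrite fmap_comp.
by rewrite (proj2_sig (fmap F g)).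
Qed.

Let L : Colimit cone_functor := mc_colim cone_functor cone_finite.

Definition pt_colim_obj : PtObj := MkPtObj (colim_inj L None).

Section PtColimMap.
Context (X : PtCat) (c : forall i, Hom (F i) X)
  (H : forall i j (u : Hom i j), c j ∘ fmap F u = c i).

Definition pt_colim_cocone (i : ConeCat) : Hom (cone_functor i) (pt_obj X) :=
  match i return Hom (cone_fobj i) (pt_obj X) with
  | None => pt_base X
  | Some a => proj1_sig (c a)
  end.

Lemma pt_colim_cocone_comm (i j : ConeCat) (u : Hom i j) :
  pt_colim_cocone j ∘ fmap cone_functor u = pt_colim_cocone i.
Proof.
case: i j u => [a|] [b|] //= u; last by rewrite comp_idr.
  by rewrite -(H u).
exact: (proj2_sig (c b)).
Qed.
End PtColimMap.

Program Definition pt_colimit : Colimit F :=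
  @MkColimit I PtCat F pt_colim_obj
    (fun i => exist _ (colim_inj L (Some i)) _) _
    (fun X c H => exist _ (colim_map L (pt_colim_cocone_comm H)) _) _ _.
Next Obligation. move=> i; exact: (colim_cocone L (i := None) (j := Some i) tt). Qed.
Next Obligation.
move=> i j u; apply: sig_ext.
exact: (colim_cocone L (i := Some i) (j := Some j) u).
Qed.
Next Obligation.
move=> X c H.
exact: (colim_map_inj L (pt_colim_cocone_comm H) None).
Qed.
Next Obligation.
move=> X c H i; apply: sig_ext.
exact: (colim_map_inj L (pt_colim_cocone_comm H) (Some i)).
Qed.
Next Obligation.
move=> X f g H; apply: sig_ext; apply: (colim_ext L); case=> [i|].
  exact: (f_equal (@proj1_sig _ _) (H i)).
exact: etrans (proj2_sig f) (esym (proj2_sig g)).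
Qed.
End PtColimit.

Program Definition Pointed : ModelCategory :=
  @MkModel PtCat (fun X Y f => Weq (proj1_sig f)) (fun X Y f => Fib (proj1_sig f))
    (fun X Y f => Cof (proj1_sig f)) pt_limit pt_colimit _ _ _ _ _.
Next Obligation. by move=> x y z g f; apply: mc_two_of_three. Qed.
Next Obligation.
move=> a b x y f g [i [r [j [s [H1 [H2 [H3 H4]]]]]]]; apply: mc_retract.
exists (proj1_sig i), (proj1_sig r), (proj1_sig j), (proj1_sig s).
split; first exact: (f_equal (@proj1_sig _ _) H1).
split; first exact: (f_equal (@proj1_sig _ _) H2).
split; first exact: (f_equal (@proj1_sig _ _) H3).
exact: (f_equal (@proj1_sig _ _) H4).
Qed.
Next Obligation.
move=> a b x y i p Hi Hp Hip u v sq.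
have [h [h1 h2]] := mc_lift Hi Hp Hip (f_equal (@proj1_sig _ _) sq).
have hb : h ∘ pt_base b = pt_base x.
  by rewrite -(proj2_sig i) comp_assoc h1 (proj2_sig u).
by exists (exist _ h hb); split; apply: sig_ext.
Qed.
Next Obligation.
move=> x y f; have [z [i [p [Hi [Wi [Hp e]]]]]] := mc_factor_weq_cof (proj1_sig f).
have pb : p ∘ (i ∘ pt_base x) = pt_base y by rewrite comp_assoc e (proj2_sig f).
exists (@MkPtObj z (i ∘ pt_base x)),
  (exist (fun h => h ∘ pt_base x = i ∘ pt_base x) i eq_refl),
  (exist (fun h => h ∘ (i ∘ pt_base x) = pt_base y) p pb).
by do 3 split=> //; apply: sig_ext.
Qed.
Next Obligation.
move=> x y f; have [z [i [p [Hi [Hp [Wp e]]]]]] := mc_factor_weq_fib (proj1_sig f).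
have pb : p ∘ (i ∘ pt_base x) = pt_base y by rewrite comp_assoc e (proj2_sig f).
exists (@MkPtObj z (i ∘ pt_base x)),
  (exist (fun h => h ∘ pt_base x = i ∘ pt_base x) i eq_refl),
  (exist (fun h => h ∘ (i ∘ pt_base x) = pt_base y) p pb).
by do 3 split=> //; apply: sig_ext.
Qed.
End Pointed.

Definition Pointed_zero (E : ModelCategory) : ZeroObject (Pointed E) := pt_zero E.

Definition fibrant (M : ModelCategory) (Z : ZeroObject M) (X : M) : Prop := Fib (to_zero Z X).
Definition cofibrant (M : ModelCategory) (Z : ZeroObject M) (X : M) : Prop := Cof (from_zero Z X).

(** A cylinder object is given by the two components of [X + X -> Cyl]. *)
Definition left_homotopic (M : ModelCategory) (X Y : M) (f g : Hom X Y) : Prop :=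
  exists (Cyl : M) (i0 i1 : Hom X Cyl) (p : Hom Cyl X) (H : Hom Cyl Y),
    Weq p /\ p ∘ i0 = idm X /\ p ∘ i1 = idm X /\ H ∘ i0 = f /\ H ∘ i1 = g.

Definition right_homotopic (M : ModelCategory) (X Y : M) (f g : Hom X Y) : Prop :=
  exists (Path : M) (d0 d1 : Hom Path Y) (s : Hom Y Path) (H : Hom X Path),
    Weq s /\ d0 ∘ s = idm Y /\ d1 ∘ s = idm Y /\ d0 ∘ H = f /\ d1 ∘ H = g.

Definition homotopic (M : ModelCategory) (X Y : M) (f g : Hom X Y) : Prop :=
  left_homotopic f g /\ right_homotopic f g.

Definition homotopy_class (M : ModelCategory) (X Y : M) (f : Hom X Y) : Hom X Y -> Prop :=
  fun g => homotopic f g.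

Definition is_homotopy_class (M : ModelCategory) (X Y : M) (c : Hom X Y -> Prop) : Prop :=
  exists f : Hom X Y, c = homotopy_class f.

(** [ho M] is the localization of [M] at its weak equivalences (Gabriel-Zisman):
    same objects, and as morphisms the zigzags [X -> . <~ . -> ... Y] of maps and
    formal inverses of weak equivalences, modulo the congruence [zz_eq]. *)
Section Homotopy.
Context (M : ModelCategory).

Inductive zigzag (X : M) : M -> Type :=
| zz_nil : zigzag X X
| zz_fwd (Y Z : M) (z : zigzag X Y) (f : Hom Y Z) : zigzag X Z
| zz_bwd (Y Z : M) (z : zigzag X Y) (w : Hom Z Y) (Hw : Weq w) : zigzag X Z.

Inductive zz_eq (X : M) : forall Y : M, zigzag X Y -> zigzag X Y -> Prop :=
| zz_refl Y (z : zigzag X Y) : zz_eq z z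
| zz_sym Y (z z' : zigzag X Y) : zz_eq z z' -> zz_eq z' z
| zz_trans Y (z1 z2 z3 : zigzag X Y) : zz_eq z1 z2 -> zz_eq z2 z3 -> zz_eq z1 z3
| zz_fwd_congr Y Z (z z' : zigzag X Y) (f : Hom Y Z) :
    zz_eq z z' -> zz_eq (zz_fwd z f) (zz_fwd z' f)
| zz_bwd_congr Y Z (z z' : zigzag X Y) (w : Hom Z Y) (Hw : Weq w) :
    zz_eq z z' -> zz_eq (zz_bwd z Hw) (zz_bwd z' Hw)
| zz_id Y (z : zigzag X Y) : zz_eq (zz_fwd z (idm Y)) z
| zz_comp Y Z T (z : zigzag X Y) (f : Hom Y Z) (g : Hom Z T) :
    zz_eq (zz_fwd (zz_fwd z f) g) (zz_fwd z (g ∘ f))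
| zz_bwd_fwd Y Z (z : zigzag X Y) (w : Hom Z Y) (Hw : Weq w) :
    zz_eq (zz_fwd (zz_bwd z Hw) w) z
| zz_fwd_bwd Y Z (z : zigzag X Y) (w : Hom Y Z) (Hw : Weq w) :
    zz_eq (zz_bwd (zz_fwd z w) Hw) z.

#[local] Set Asymmetric Patterns.
Fixpoint zz_cat (X Y Z : M) (z1 : zigzag X Y) (z2 : zigzag Y Z) : zigzag X Z :=
  match z2 in zigzag _ Z' return zigzag X Z' with
  | zz_nil => z1
  | zz_fwd _ _ z f => zz_fwd (zz_cat z1 z) f
  | zz_bwd _ _ z w Hw => zz_bwd (zz_cat z1 z) Hw
  end.

Lemma zz_cat_congr (X Y Z : M) (z1 z1' : zigzag X Y) (z2 z2' : zigzag Y Z) :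
  zz_eq z1 z1' -> zz_eq z2 z2' -> zz_eq (zz_cat z1 z2) (zz_cat z1' z2').
Proof.
move=> e1 e2; apply: (@zz_trans _ _ _ (zz_cat z1' z2)).
  by elim: z2 {e2 z2'} => //= *; [apply: zz_fwd_congr | apply: zz_bwd_congr].
elim: e2 => /= *; [exact: zz_refl | exact: zz_sym | by apply: zz_trans; eassumption
  | exact: zz_fwd_congr | exact: zz_bwd_congr | exact: zz_id | exact: zz_comp
  | exact: zz_bwd_fwd | exact: zz_fwd_bwd].
Qed.

Lemma zz_cat_nil (X Y : M) (z : zigzag X Y) : zz_cat (zz_nil X) z = z.
Proof. by elim: z => //= [Y' Z z -> | Y' Z z -> ]. Qed.

Lemma zz_cat_assoc (W X Y Z : M) (z1 : zigzag W X) (z2 : zigzag X Y) (z3 : zigzag Y Z) :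
  zz_cat z1 (zz_cat z2 z3) = zz_cat (zz_cat z1 z2) z3.
Proof. by elim: z3 => //= [Y' Z' z -> | Y' Z' z -> ]. Qed.

Definition ho_hom (X Y : M) : Type :=
  {c : zigzag X Y -> Prop | exists z, c = zz_eq z}.

Definition ho_class (X Y : M) (z : zigzag X Y) : ho_hom X Y :=
  exist _ (zz_eq z) (ex_intro _ z eq_refl).

Definition ho_repr (X Y : M) (c : ho_hom X Y) : zigzag X Y :=
  proj1_sig (constructive_indefinite_description _ (proj2_sig c)).

Lemma ho_reprK (X Y : M) (c : ho_hom X Y) : ho_class (ho_repr c) = c.
Proof.
apply: sig_ext; rewrite /= /ho_repr.
by case: constructive_indefinite_description => z /= ->.
Qed.

Lemma ho_class_eq (X Y : M) (z z' : zigzag X Y) : ho_class z = ho_class z' <-> zz_eq z z'.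
Proof.
split=> [/(f_equal (@proj1_sig _ _)) /= -> | e]; first exact: zz_refl.
apply: sig_ext; apply: functional_extensionality => t /=.
apply: propositional_extensionality; split=> h; first exact: zz_trans (zz_sym e) h.
exact: zz_trans e h.
Qed.

Lemma ho_repr_class (X Y : M) (z : zigzag X Y) : zz_eq (ho_repr (ho_class z)) z.
Proof. by apply/ho_class_eq; rewrite ho_reprK. Qed.

Definition ho_comp (X Y Z : M) (g : ho_hom Y Z) (f : ho_hom X Y) : ho_hom X Z :=
  ho_class (zz_cat (ho_repr f) (ho_repr g)).

Lemma ho_comp_class (X Y Z : M) (g : zigzag Y Z) (f : zigzag X Y) :
  ho_comp (ho_class g) (ho_class f) = ho_class (zz_cat f g).
Proof. by apply/ho_class_eq; apply: zz_cat_congr; apply: ho_repr_class. Qed.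

Program Definition ho : Category :=
  @MkCategory M ho_hom (fun X => ho_class (zz_nil X)) ho_comp _ _ _.
Next Obligation. by move=> X Y f; rewrite -(ho_reprK f) ho_comp_class. Qed.
Next Obligation. by move=> X Y f; rewrite -(ho_reprK f) ho_comp_class zz_cat_nil. Qed.
Next Obligation.
move=> W X Y Z h g f; rewrite -(ho_reprK f) -(ho_reprK g) -(ho_reprK h).
by rewrite !ho_comp_class zz_cat_assoc.
Qed.

Program Definition to_ho : Functor M ho :=
  @MkFunctor M ho (fun X => X) (fun X Y f => ho_class (zz_fwd (zz_nil X) f)) _ _.
Next Obligation. by move=> X; apply/ho_class_eq; apply: zz_id. Qed.
Next Obligation.
move=> X Y Z g f /=; rewrite ho_comp_class; apply/ho_class_eq => /=.
exact/zz_sym/zz_comp.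
Qed.

Lemma zz_zero (Z : ZeroObject M) (X Y : M) (z : zigzag X Y) :
  zz_eq (zz_fwd z (to_zero Z Y)) (zz_fwd (zz_nil X) (to_zero Z X)).
Proof.
elim: z => [|Y' Y'' z IH f|Y' Y'' z IH w Hw]; first exact: zz_refl.
  by apply: zz_trans (zz_comp _ _ _) _; rewrite (to_zero_unique (_ ∘ f)).
rewrite -(to_zero_unique (to_zero Z Y' ∘ w)).
apply: zz_trans (zz_sym (zz_comp _ _ _)) _.
exact: zz_trans (zz_fwd_congr _ (zz_bwd_fwd _ _)) IH.
Qed.

Lemma zz_from_zero (Z : ZeroObject M) (Y : M) (z : zigzag Z Y) :
  zz_eq z (zz_fwd (zz_nil (Z : M)) (from_zero Z Y)).
Proof.
elim: z => [|Y' Y'' z IH f|Y' Y'' z IH w Hw].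
- by rewrite -(from_zero_unique (idm (Z : M))); apply/zz_sym/zz_id.
- apply: zz_trans (zz_fwd_congr _ IH) _.
  by apply: zz_trans (zz_comp _ _ _) _; rewrite (from_zero_unique (f ∘ _)); apply: zz_refl.
- apply: zz_trans (zz_bwd_congr _ IH) _.
  rewrite -(from_zero_unique (w ∘ from_zero Z Y'')).
  apply: zz_trans (zz_bwd_congr _ (zz_sym (zz_comp _ _ _))) _.
  exact: zz_fwd_bwd.
Qed.

Program Definition ho_zero (Z : ZeroObject M) : ZeroObject ho :=
  @MkZero ho (Z : M) (fun X => fmap to_ho (to_zero Z X))
    (fun X => fmap to_ho (from_zero Z X)) _ _.
Next Obligation.
move=> Z X f; rewrite -(ho_reprK f); apply/ho_class_eq.
apply: zz_trans (zz_zero Z (ho_repr f)).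
by rewrite -(to_zero_unique (idm (Z : M))); apply/zz_sym/zz_id.
Qed.
Next Obligation.
by move=> Z X f; rewrite -(ho_reprK f); apply/ho_class_eq; apply: zz_from_zero.
Qed.

(** A functor [C -> M] lifts [G : C -> ho M] if it has [G] as composite with
    [to_ho].  As [to_ho] is the identity on objects, a lift has the same values on
    objects as [G], and is determined by its action on morphisms; see
    [compose_to_ho_lift] and [lift_of_compose]. *)
Record Lift (C : Category) (G : Functor C ho) := MkLift {
  lift_map : forall s t : C, Hom s t -> @Hom M (G s) (G t);
  lift_id : forall s, lift_map (idm s) = @idm M (G s);
  lift_comp : forall r s t (g : Hom s t) (f : Hom r s),
    lift_map (g ∘ f) = @comp M _ _ _ (lift_map g) (lift_map f);
  lift_to_ho : forall s t (f : Hom s t), fmap to_ho (lift_map f) = fmap G f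
}.

Definition lift_functor (C : Category) (G : Functor C ho) (Y : Lift G) : Functor C M :=
  @MkFunctor C M (fun s => G s) (lift_map Y) (lift_id Y) (lift_comp Y).
End Homotopy.
Arguments to_ho {_}.
Arguments lift_map {_ _ _} _ {_ _} _.
Coercion lift_functor : Lift >-> Functor.

Lemma functor_eq (C D : Category) (o : C -> D) m1 m2 i1 i2 c1 c2 :
  (forall x y (f : Hom x y), m1 x y f = m2 x y f) ->
  @MkFunctor C D o m1 i1 c1 = @MkFunctor C D o m2 i2 c2.
Proof.
move=> e; have {}e : m1 = m2.
  by do 3 apply: functional_extensionality_dep => ?; apply: e.
by case: m2 / e i2 c2 => i2 c2; congr MkFunctor; apply: proof_irrelevance.
Qed.

Lemma lift_eq (M : ModelCategory) (C : Category) (G : Functor C (ho M)) (Y1 Y2 : Lift G) :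
  (forall s t (f : Hom s t), lift_map Y1 f = lift_map Y2 f) -> Y1 = Y2.
Proof.
case: Y1 Y2 => [m1 i1 c1 h1] [m2 i2 c2 h2] /= e.
have {}e : m1 = m2 by do 3 apply: functional_extensionality_dep => ?; apply: e.
by case: m2 / e i2 c2 h2 => i2 c2 h2; congr MkLift; apply: proof_irrelevance.
Qed.

Lemma compose_to_ho_lift (M : ModelCategory) (C : Category) (G : Functor C (ho M))
    (Y : Lift G) : fcompose to_ho (lift_functor Y) = G.
Proof. by case: G Y => [o m i c] Y; apply: functor_eq => s t f; apply: lift_to_ho. Qed.

Lemma lift_of_compose (M : ModelCategory) (C : Category) (G : Functor C (ho M))
    (F : Functor C M) :
  fcompose to_ho F = G -> exists Y : Lift G, lift_functor Y = F.
Proof.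
move=> <-; case: F => o m i c.
by exists (@MkLift M C (fcompose to_ho (MkFunctor i c)) m i c (fun _ _ _ => eq_refl)).
Qed.

Program Definition restrict_lift (M : ModelCategory) (C : Category) (G : Functor C (ho M))
    (P Q : C -> Prop) (PQ : forall t, P t -> Q t) (Y : Lift (restrict G Q)) :
    Lift (restrict G P) :=
  let i (s : Full P) : Full Q := exist _ (proj1_sig s) (PQ _ (proj2_sig s)) in
  @MkLift M (Full P) (restrict G P)
    (fun s t f => lift_map Y (s := i s) (t := i t) f) _ _ _.
Next Obligation. move=> M C G P Q PQ Y i s; exact: (lift_id Y (i s)). Qed.
Next Obligation.
move=> M C G P Q PQ Y i r s t g f; exact: (lift_comp Y (r := i r) (s := i s) (t := i t)).
Qed.
Next Obligation.
move=> M C G P Q PQ Y i s t f; exact: (lift_to_ho Y (s := i s) (t := i t)).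
Qed.

(** Since every non-identity morphism lowers the degree, the Reedy structure is the
    one in which all morphisms are in the inverse subcategory and only the identities
    are in the direct one; it carries no further data. *)
Record WeakLattice := MkWeakLattice {
  wl_cat :> Category;
  deg : wl_cat -> nat;
  wl_connected : inhabited wl_cat /\
    forall s t : wl_cat,
      clos_refl_sym_trans wl_cat (fun a b => inhabited (Hom a b)) s t;
  wl_hom_finite : forall s t : wl_cat, Finite (Hom s t);
  wl_deg_finite : forall d : nat, Finite {t : wl_cat | deg t = d};
  wl_deg_decr : forall (s t : wl_cat) (f : Hom s t), ~ is_identity f -> deg t < deg s;
  wl_to_deg0 : forall s : wl_cat, exists t : wl_cat, inhabited (Hom s t) /\ deg t = 0
}.
Arguments deg {_} _.

(** [null f] is the membership of [f] in the part [Jbar] of the partition of the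
    morphisms, so that [Jtilde] is its complement. *)
Record PointedWeakLattice := MkPointedWeakLattice {
  pwl :> WeakLattice;
  null : forall s t : pwl, Hom s t -> bool;
  null_id : forall s : pwl, null (idm s) = true <-> is_zero_object s;
  null_comp : forall (r s t : pwl) (g : Hom s t) (f : Hom r s),
    null g = true \/ null f = true -> null (g ∘ f) = true
}.
Arguments null {_ _ _} _.

Section Subcategories.
Context (J : PointedWeakLattice).

Definition under_obj (x t : J) : Prop := inhabited (Hom x t).
Definition truncated_obj (x : J) (k : nat) (t : J) : Prop :=
  under_obj x t /\ (t = x \/ deg t <= k).

(** [Full (truncated_obj x k)] is [J^x_k], and [Full (boundary_obj x k)] is its
    boundary. *)
Definition boundary_obj (x : J) (k : nat) (t : J) : Prop :=
  truncated_obj x k t /\ t <> x.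

Definition pointed (C : Category) (Z : ZeroObject C) (Y : Functor J C) : Prop :=
  forall (s t : J) (f : Hom s t), null f = true -> fmap Y f = zero_map Z (Y s) (Y t).

Definition pointed_functor (P : J -> Prop) (C : Category) (Z : ZeroObject C)
    (Y : Functor (Full P) C) : Prop :=
  forall (s t : Full P) (f : @Hom J (proj1_sig s) (proj1_sig t)),
    null f = true -> fmap Y (x := s) (y := t) f = zero_map Z (Y s) (Y t).

Record Under (s : J) (j : nat) := MkUnder {
  tgt : J;
  arr : Hom s tgt;
  tgt_deg : deg tgt <= j
}.

Program Definition under_cat (s : J) (j : nat) : Category :=
  @MkCategory (Under s j) (fun u v => {h : Hom (tgt u) (tgt v) | h ∘ arr u = arr v})
    (fun u => exist _ (idm (tgt u)) (comp_idl _))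
    (fun u v w g f => exist _ (proj1_sig g ∘ proj1_sig f) _) _ _ _.
Next Obligation. by move=> s j u v w [g Hg] [f Hf] /=; rewrite -comp_assoc Hf. Qed.
Next Obligation. by move=> *; apply: sig_ext; apply: comp_idl. Qed.
Next Obligation. by move=> *; apply: sig_ext; apply: comp_idr. Qed.
Next Obligation. by move=> *; apply: sig_ext; apply: comp_assoc. Qed.

Definition RUnder (s : J) (j : nat) := {u : Under s j | null (arr u) = false}.
Definition RUnderEq (s : J) (k : nat) :=
  {u : Under s k | deg (tgt u) = k /\ null (arr u) = false}.

Lemma finite_sig (A : Type) (P : A -> Prop) : Finite A -> Finite {a | P a}.
Proof.
case=> l Hl.
exists (flat_map (fun a => match excluded_middle_informative (P a) with
                           | left H => exist _ a H :: nil | right _ => nil end) l).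
case=> a Ha; apply/in_flat_map; exists a; split; first exact: Hl.
case: excluded_middle_informative => // H; left; exact: sig_ext.
Qed.

Lemma finite_deg_le (j : nat) : Finite {t : J | deg t <= j}.
Proof.
elim: j => [|j [l Hl]].
  have [l Hl] := wl_deg_finite J 0.
  exists (List.map (fun t => exist (fun t => deg t <= 0) (proj1_sig t)
                          (Nat.eq_le_incl _ _ (proj2_sig t))) l).
  case=> t Ht; apply/in_map_iff.
  have e : deg t = 0 by lia.
  by exists (exist _ t e); split; [apply: sig_ext | apply: Hl].
have [l' Hl'] := wl_deg_finite J (S j).
exists (List.map (fun t => exist (fun t => deg t <= S j) (proj1_sig t)
                   (Nat.le_trans _ _ _ (proj2_sig t) (Nat.le_succ_diag_r j))) l
     ++ List.map (fun t => exist (fun t => deg t <= S j) (proj1_sig t)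
                          (Nat.eq_le_incl _ _ (proj2_sig t))) l').
case=> t Ht; apply/in_app_iff.
have [e|e] : deg t <= j \/ deg t = S j by lia.
  left; apply/in_map_iff; exists (exist _ t e); split; [exact: sig_ext | exact: Hl].
right; apply/in_map_iff; exists (exist _ t e); split; [exact: sig_ext | exact: Hl'].
Qed.

Lemma under_finite (s : J) (j : nat) : Finite (Under s j).
Proof.
have [l Hl] := finite_deg_le j.
pose h t := proj1_sig (constructive_indefinite_description _ (wl_hom_finite s t)).
exists (flat_map (fun t => List.map (fun f => MkUnder f (proj2_sig t)) (h (proj1_sig t))) l).
case=> t f Ht; apply/in_flat_map; exists (exist _ t Ht); split; first exact: Hl.
apply/in_map_iff; exists f; split=> //.
rewrite /h; case: constructive_indefinite_description => l' Hl' /=; exact: Hl'.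
Qed.

Lemma under_cat_finite (s : J) (j : nat) : finite_category (under_cat s j).
Proof. by split=> [|u v]; [apply: under_finite | apply/finite_sig/wl_hom_finite]. Qed.

Lemma runder_finite (s : J) (j : nat) : Finite (RUnder s j).
Proof. exact/finite_sig/under_finite. Qed.

Lemma runder_eq_finite (s : J) (k : nat) : Finite (RUnderEq s k).
Proof. exact/finite_sig/under_finite. Qed.

Lemma boundary_below (x : J) (k : nat) (hk : k < deg x) (s : J) (j : nat) :
  under_obj x s -> j <= k ->
  forall u : Under s j, boundary_obj x k (tgt u).
Proof.
move=> [g] jk [t f Ht] /=; split; last by move=> e; subst t; lia.
by split; [constructor; exact: (f ∘ g) | right; lia].
Qed.

Lemma truncated_boundary (x : J) (k : nat) (t : J) :
  boundary_obj x k t -> truncated_obj x k t.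
Proof. by case. Qed.

Lemma truncated_mono (x : J) (j k : nat) (jk : j <= k) (t : J) :
  truncated_obj x j t -> truncated_obj x k t.
Proof. by move=> [? [?|?]]; split=> //; [left | right; lia]. Qed.

Lemma boundary_mono (x : J) (j k : nat) (jk : j <= k) (t : J) :
  boundary_obj x j t -> boundary_obj x k t.
Proof. by move=> [h ne]; split=> //; apply: truncated_mono h. Qed.

Lemma truncated_self (x : J) (k : nat) : truncated_obj x k x.
Proof. by split; [constructor; exact: idm | left]. Qed.

Lemma truncated_under (x : J) (k : nat) (u : Under x k) : truncated_obj x k (tgt u).
Proof. by case: u => t f h; split; [constructor | right]. Qed.
End Subcategories.

(** [Y] is defined on any full subcategory of [J] that contains all objects of degree
    at most [j] under [s]. *)
Section Matching.
Context (M : ModelCategory) (Z : ZeroObject M) (J : PointedWeakLattice).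
Context (P : J -> Prop) (Y : Functor (Full P) M).
Context (s : J) (j : nat) (below : forall u : Under s j, P (tgt u)).

Definition under_incl_obj (u : Under s j) : Full P := exist _ (tgt u) (below u).

Program Definition under_incl : Functor (under_cat s j) (Full P) :=
  @MkFunctor (under_cat s j) (Full P) under_incl_obj (fun u v h => proj1_sig h) _ _.
Next Obligation. by []. Qed.
Next Obligation. by []. Qed.

Definition at_under (u : Under s j) : M := Y (under_incl_obj u).

Definition matching : Limit (fcompose Y under_incl) :=
  mc_lim (fcompose Y under_incl) (under_cat_finite s j).

Definition full_product : M := product (under_finite s j) at_under.

Definition reduced_product : M :=
  product (runder_finite s j) (fun r => at_under (proj1_sig r)).

Definition matching_incl : Hom matching full_product :=
  tuple (under_finite s j) (fun u => lim_proj matching u).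

Definition Theta_component (u : Under s j) : Hom reduced_product (at_under u) :=
  match bool_dec (null (arr u)) false with
  | left nz => proj (runder_finite s j) (fun r => at_under (proj1_sig r)) (exist _ u nz)
  | right _ => zero_map Z reduced_product (at_under u)
  end.

Definition Theta : Hom reduced_product full_product :=
  tuple (under_finite s j) Theta_component.

Definition reduced_matching : Limit (cospan_functor matching_incl Theta) :=
  pullback matching_incl Theta.

Definition forget : Hom reduced_matching reduced_product := pb_snd matching_incl Theta.

Section Map.
Context (X : M) (c : forall u : Under s j, Hom X (at_under u)).
Context (c_nat : forall (u v : under_cat s j) (h : Hom u v),
  fmap (fcompose Y under_incl) h ∘ c u = c v).
Context (c_null : forall u, null (arr u) = true -> c u = zero_map Z X (at_under u)).

Lemma reduced_matching_map_comm :
  matching_incl ∘ lim_map matching c_nat =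
  Theta ∘ tuple (runder_finite s j) (fun r => c (proj1_sig r)).
Proof.
apply: product_ext => u.
rewrite !comp_assoc /matching_incl /Theta !proj_tuple lim_map_proj.
rewrite /Theta_component; case: bool_dec => [nz|nn].
  exact/esym/(proj_tuple (runder_finite s j) (fun r => c (proj1_sig r)) (exist _ u nz)).
by rewrite comp_zero_l c_null //; case: (null (arr u)) nn.
Qed.

Definition reduced_matching_map : Hom X reduced_matching :=
  pb_pair reduced_matching_map_comm.
End Map.
End Matching.

Section MatchingMap.
Context (M : ModelCategory) (Z : ZeroObject M) (J : PointedWeakLattice).
Context (P : J -> Prop) (Y : Functor (Full P) M) (Ypt : pointed_functor Z Y).
Context (s : Full P) (j : nat) (below : forall u : Under (proj1_sig s) j, P (tgt u)).

Definition matching_component (u : Under (proj1_sig s) j) : Hom (Y s) (at_under Y below u) :=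
  fmap Y (x := s) (y := under_incl_obj below u) (arr u).

Lemma matching_component_nat (u v : under_cat (proj1_sig s) j) (h : Hom u v) :
  fmap (fcompose Y (under_incl below)) h ∘ matching_component u = matching_component v.
Proof. by rewrite /matching_component /= -(fmap_comp Y) /= (proj2_sig h). Qed.

Lemma matching_component_null (u : Under (proj1_sig s) j) :
  null (arr u) = true -> matching_component u = zero_map Z (Y s) (at_under Y below u).
Proof. exact: (@Ypt s (under_incl_obj below u) (arr u)). Qed.

Definition matching_map : Hom (Y s) (reduced_matching Z Y below) :=
  reduced_matching_map matching_component_nat matching_component_null.
End MatchingMap.

Lemma boundary_below_pred (J : PointedWeakLattice) (x : J) (k : nat) (hk : k < deg x)
    (s : J) (hs : boundary_obj x k s) (j : nat) (hj : deg s = S j) (u : Under s j) :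
  boundary_obj x k (tgt u).
Proof.
case: hs => -[xs [//|dk]] ne; apply: (boundary_below hk xs _ u); lia.
Qed.

Definition Reedy_fibrant (M : ModelCategory) (Z : ZeroObject M) (J : PointedWeakLattice)
    (x : J) (k : nat) (hk : k < deg x) (Y : Functor (Full (boundary_obj x k)) M)
    (Ypt : pointed_functor Z Y) : Prop :=
  forall s : Full (boundary_obj x k),
    (deg (proj1_sig s) = 0 -> fibrant Z (Y s)) /\
    (forall (j : nat) (hj : deg (proj1_sig s) = S j),
       Fib (matching_map Ypt (boundary_below_pred hk (proj2_sig s) hj))).

Section Operation.
Context (M : ModelCategory) (Z : ZeroObject M) (J : PointedWeakLattice).
Context (Yt : Functor J (ho M)).
Context (x : J) (k : nat) (hk : k < deg x).
Context (Yk : Lift (restrict Yt (boundary_obj x k))) (Yk_pt : pointed_functor Z Yk).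
Context (Yx : Lift (restrict Yt (truncated_obj x (k - 1)))) (Yx_pt : pointed_functor Z Yx).
Context (agree :
  restrict_lift (boundary_mono (Nat.le_sub_l k 1)) Yk =
  restrict_lift (@truncated_boundary J x (k - 1)) Yx).

(** The value at [t] of [Yt], hence of all its lifts. *)
Definition val (t : J) : M := Yt t.

Definition top_obj : Full (truncated_obj x (k - 1)) := exist _ x (truncated_self x (k - 1)).

Definition Yx_at (u : Under x (k - 1)) : Hom (val x) (val (tgt u)) :=
  lift_map Yx (s := top_obj) (t := exist _ (tgt u) (truncated_under u)) (arr u).

(** The double products over objects [t] and morphisms [x -> t] are indexed by the
    pairs.  As [0 < k], [|t| < k] is written as [deg t <= k - 1]. *)
Definition prod_lt : M :=
  product (runder_finite x (k - 1)) (fun r => val (tgt (proj1_sig r))).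

Definition sigma_lt : Hom (val x) prod_lt :=
  tuple (runder_finite x (k - 1)) (fun r => Yx_at (proj1_sig r)).

Definition prod_eq : M :=
  product (runder_eq_finite x k) (fun g => val (tgt (proj1_sig g))).

Definition represents_Yt (sigma : Hom (val x) prod_eq) : Prop :=
  forall g : RUnderEq x k,
    fmap to_ho (proj (runder_eq_finite x k) (fun g => val (tgt (proj1_sig g))) g ∘ sigma) =
    fmap Yt (arr (proj1_sig g)).

Lemma below_g (g : RUnderEq x k) (u : Under (tgt (proj1_sig g)) (k - 1)) :
  boundary_obj x k (tgt u).
Proof.
by apply: (boundary_below hk _ (Nat.le_sub_l k 1)); constructor; apply: arr.
Qed.

Lemma boundary_g (g : RUnderEq x k) : boundary_obj x k (tgt (proj1_sig g)).
Proof.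
case: g => -[t f ht] /= [e _].
by split; [split; [constructor | right] | move=> e'; subst t; lia].
Qed.

Definition obj_g (g : RUnderEq x k) : Full (boundary_obj x k) :=
  exist _ (tgt (proj1_sig g)) (boundary_g g).

Definition Mbar (g : RUnderEq x k) : Limit (cospan_functor _ _) :=
  reduced_matching Z Yk (below_g (g := g)).

Definition prod_Mbar : M := product (runder_eq_finite x k) (fun g => Mbar g).

Definition prod_eq_lt : M :=
  product (runder_eq_finite x k) (fun g => reduced_product Yk (below_g (g := g))).

Definition alpha : Hom prod_eq prod_Mbar :=
  product_map (runder_eq_finite x k)
    (fun g => matching_map Yk_pt (s := obj_g g) (below_g (g := g))).

Definition beta : Hom prod_Mbar prod_eq_lt :=
  product_map (runder_eq_finite x k) (fun g => forget Z Yk (below_g (g := g))).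

Definition under_comp (g : RUnderEq x k) (u : Under (tgt (proj1_sig g)) (k - 1)) :
    Under x (k - 1) :=
  MkUnder (arr u ∘ arr (proj1_sig g)) (tgt_deg u).

Definition Psi_component (g : RUnderEq x k) (f : RUnder (tgt (proj1_sig g)) (k - 1)) :
    Hom prod_lt (at_under Yk (below_g (g := g)) (proj1_sig f)) :=
  match bool_dec (null (arr (under_comp (proj1_sig f)))) false with
  | left nz => proj (runder_finite x (k - 1)) (fun r => val (tgt (proj1_sig r)))
                 (exist _ (under_comp (proj1_sig f)) nz)
  | right _ => zero_map Z _ _
  end.

Definition Psi : Hom prod_lt prod_eq_lt :=
  tuple (runder_eq_finite x k)
    (fun g => tuple (runder_finite (tgt (proj1_sig g)) (k - 1)) (Psi_component (g := g))).

Definition Qbar : Limit (cospan_functor Psi beta) := pullback Psi beta.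

Lemma boundary_lt (u : Under x (k - 1)) : boundary_obj x (k - 1) (tgt u).
Proof.
case: u => t f ht /=.
by split; [split; [constructor | right] | move=> e'; subst t; lia].
Qed.

Lemma agree_map (u v : Under x (k - 1)) (h : Hom (tgt u) (tgt v))
    (hu : boundary_obj x k (tgt u)) (hv : boundary_obj x k (tgt v)) :
  lift_map Yk (s := exist _ (tgt u) hu) (t := exist _ (tgt v) hv) h =
  lift_map Yx (s := exist _ (tgt u) (truncated_under u))
              (t := exist _ (tgt v) (truncated_under v)) h.
Proof.
have e := f_equal (fun L : Lift (restrict Yt (boundary_obj x (k - 1))) =>
  lift_map L (s := exist _ (tgt u) (boundary_lt u))
             (t := exist _ (tgt v) (boundary_lt v)) h) agree.
rewrite /= in e.
rewrite (proof_irrelevance _ hu (boundary_mono (Nat.le_sub_l k 1) (boundary_lt u))).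
rewrite (proof_irrelevance _ hv (boundary_mono (Nat.le_sub_l k 1) (boundary_lt v))).
rewrite e.
by rewrite (proof_irrelevance _ (truncated_under u) (truncated_boundary (boundary_lt u)))
  (proof_irrelevance _ (truncated_under v) (truncated_boundary (boundary_lt v))).
Qed.

Definition zeta_component (g : RUnderEq x k) (u : Under (tgt (proj1_sig g)) (k - 1)) :
    Hom (val x) (at_under Yk (below_g (g := g)) u) :=
  Yx_at (under_comp u).

Lemma zeta_component_nat (g : RUnderEq x k)
    (u v : under_cat (tgt (proj1_sig g)) (k - 1)) (h : Hom u v) :
  fmap (fcompose Yk (under_incl (below_g (g := g)))) h ∘ zeta_component u =
  zeta_component v.
Proof.
have e := @agree_map (under_comp u) (under_comp v) (proj1_sig h)
  (below_g u) (below_g v).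
rewrite /zeta_component /= /Yx_at /=.
apply: etrans (f_equal (fun m => m ∘ _) e) _.
apply: etrans (esym (lift_comp Yx (r := top_obj)
  (s := exist _ _ (truncated_under (under_comp u)))
  (t := exist _ _ (truncated_under (under_comp v))) _ _)) _.
by rewrite /= comp_assoc (proj2_sig h).
Qed.

Lemma zeta_component_null (g : RUnderEq x k) (u : Under (tgt (proj1_sig g)) (k - 1)) :
  null (arr u) = true ->
  zeta_component u = zero_map Z (val x) (at_under Yk (below_g (g := g)) u).
Proof.
move=> nu; apply: (@Yx_pt top_obj (exist _ _ (truncated_under (under_comp u)))).
by apply: null_comp; left.
Qed.

Definition zeta (g : RUnderEq x k) : Hom (val x) (Mbar g) :=
  reduced_matching_map (zeta_component_nat (g := g)) (zeta_component_null (g := g)).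

Lemma eta_comm :
  Psi ∘ sigma_lt = beta ∘ tuple (runder_eq_finite x k) zeta.
Proof.
apply: product_ext => g; apply: product_ext => f.
have ePsi : proj (runder_eq_finite x k) _ g ∘ Psi = tuple _ (Psi_component (g := g)).
  exact: (proj_tuple _ (fun g => tuple _ (Psi_component (g := g)))).
have ebeta : proj (runder_eq_finite x k) _ g ∘ beta =
    forget Z Yk (below_g (g := g)) ∘ proj (runder_eq_finite x k) _ g.
  exact: (proj_tuple (runder_eq_finite x k)
    (fun g => forget Z Yk (below_g (g := g)) ∘ proj _ _ g)).
have ezeta : proj (runder_eq_finite x k) _ g ∘ tuple _ zeta = zeta g.
  exact: (proj_tuple (runder_eq_finite x k) zeta g).
have eforget : forget Z Yk (below_g (g := g)) ∘ zeta g =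
    tuple (runder_finite (tgt (proj1_sig g)) (k - 1))
      (fun r => zeta_component (proj1_sig r)) by exact: pb_snd_pair.
rewrite (comp_assoc _ Psi) ePsi (comp_assoc _ beta) ebeta.
rewrite -(comp_assoc _ (proj _ _ g)) ezeta eforget.
apply: etrans (comp_assoc _ _ _) _.
have e := proj_tuple (runder_finite (tgt (proj1_sig g)) (k - 1)) (Psi_component (g := g)) f.
apply: etrans (f_equal (fun m => m ∘ sigma_lt) e) _.
apply: etrans _ (esym (proj_tuple (runder_finite (tgt (proj1_sig g)) (k - 1))
  (fun r => zeta_component (proj1_sig r)) f)).
rewrite /Psi_component; case: bool_dec => [nz|nn].
  exact: (proj_tuple (runder_finite x (k - 1)) (fun r => Yx_at (proj1_sig r))
    (exist _ (under_comp (proj1_sig f)) nz)).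
apply: etrans (comp_zero_l _ _ _) _; apply/esym; apply: (@Yx_pt top_obj
  (exist _ _ (truncated_under (under_comp (proj1_sig f))))).
by move: nn; rewrite /=; case: (null _).
Qed.

Definition eta : Hom (val x) Qbar := pb_pair eta_comm.

Record PsiFactorization := MkPsiFactorization {
  F1 : M;
  iota : Hom prod_lt F1;
  Psi' : Hom F1 prod_eq_lt;
  iota_weq : Weq iota;
  iota_cof : Cof iota;
  Psi'_fib : Fib Psi';
  Psi_factor : Psi = Psi' ∘ iota
}.

Context (sigma_eq : Hom (val x) prod_eq) (fact : PsiFactorization).

Definition F2 : Limit (cospan_functor (Psi' fact) beta) := pullback (Psi' fact) beta.

Definition q : Hom F2 (F1 fact) := pb_fst (Psi' fact) beta.

Lemma gamma_comm :
  Psi' fact ∘ (iota fact ∘ pb_fst Psi beta) = beta ∘ pb_snd Psi beta.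
Proof. by rewrite comp_assoc -Psi_factor; apply: pb_square. Qed.

Definition gamma : Hom Qbar F2 := pb_pair gamma_comm.

(** A set of homotopy classes of maps [Y(x) -> F2]: those that contain some
    [theta] with the two properties. *)
Definition operation (c : Hom (val x) F2 -> Prop) : Prop :=
  is_homotopy_class c /\
  exists theta : Hom (val x) F2,
    c theta /\
    Psi' fact ∘ q ∘ theta = beta ∘ alpha ∘ sigma_eq /\
    homotopic (q ∘ theta) (iota fact ∘ sigma_lt).

Definition vanishes : Prop := operation (homotopy_class (gamma ∘ eta)).
End Operation.

(* Main.v *)
Require Import Defs.
From Stdlib Require Import Arith Lia Bool Classical ClassicalEpsilon ProofIrrelevance.
From Corelib Require Import ssreflect ssrfun ssrbool.

(** Write [sigma_{<k}], [zeta] for the maps determined by [Y^x_{k-1}], so that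
    [eta = (sigma_{<k}, zeta)].  An extension of [Y_k] and [Y^x_{k-1}] amounts to a map
    [sigma : Y(x) -> prod Y(s)], homotopic to [sigma_k], with [alpha sigma = zeta]; this
    equation expresses functoriality on all composites [x -> s -> v] with [|s| = k].

    As [forget] is a monomorphism, so is [beta], and the first condition on [theta] says
    that its component in [prod Mbar] is [alpha sigma_k].  If [theta] is homotopic to
    [gamma eta], then [alpha sigma_k] is homotopic to [zeta], and lifting this homotopy
    through the fibration [alpha] moves [sigma_k] to the required [sigma].  Conversely, a
    homotopy from [sigma] to [sigma_k] gives one from [zeta] to [alpha sigma_k]; lifting it
    through the fibration [Psi'] gives a homotopy in [F2] from [gamma eta] to some [theta].

    That maps from a cofibrant [X] to a fibrant object are homotopic as soon as they agree
    in [ho M] is seen by letting zigzags starting at [X] act on the homotopy classes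
    [[X, R Y]], where [R] is fibrant replacement: on these every weak equivalence induces
    a bijection. *)

Set Implicit Arguments.
Unset Strict Implicit.
Unset Printing Implicit Defensive.

Local Open Scope cat_scope.

(** * Lifting properties, binary coproducts and products *)

Lemma weq_id (M : ModelCategory) (x : M) : Weq (idm x).
Proof.
have [z [i [p [_ [wi [_ e]]]]]] := mc_factor_weq_cof (idm x).
(* The axioms do not list identities as weak equivalences; as [p i] is the identity, it is a retract
   of the acyclic cofibration [i]. *)
apply: (proj1 (mc_retract (f := idm x) (g := i) _)) wi.
by exists (idm x), (idm x), i, p; rewrite !comp_idl comp_idr e.
Qed.

Lemma weq_retraction (M : ModelCategory) (x y : M) (i : Hom x y) (p : Hom y x) :
  p ∘ i = idm x -> (Weq p <-> Weq i).
Proof.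
move=> e; have W : Weq (p ∘ i) by rewrite e; apply: weq_id.
have [_ [h1 h2]] := mc_two_of_three p i.
by split=> w; [apply: h2 | apply: h1].
Qed.

Definition lifts_against (M : ModelCategory) (a b x y : M) (i : Hom a b) (p : Hom x y) : Prop :=
  forall (u : Hom a x) (v : Hom b y), p ∘ u = v ∘ i ->
  exists h : Hom b x, h ∘ i = u /\ p ∘ h = v.

(** Retract argument: lifting against the acyclic cofibration in a factorization of [p] makes [p] a
    retract of the fibration in it. *)
Lemma fib_of_lifts (M : ModelCategory) (x y : M) (p : Hom x y) :
  (forall (a b : M) (i : Hom a b), Cof i -> Weq i -> lifts_against i p) -> Fib p.
Proof.
move=> H; have [z [i [p' [ci [wi [fp' e]]]]]] := mc_factor_weq_cof p.
have [|h [h1 h2]] := H _ _ i ci wi (idm x) p'; first by rewrite comp_idr.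
apply: (proj1 (proj2 (mc_retract (f := p) (g := p') _))) fp'.
by exists i, h, (idm y), (idm y); rewrite !comp_idl.
Qed.

Lemma cof_of_lifts (M : ModelCategory) (a b : M) (i : Hom a b) :
  (forall (x y : M) (p : Hom x y), Fib p -> Weq p -> lifts_against i p) -> Cof i.
Proof.
move=> H; have [z [j [p [cj [fp [wp e]]]]]] := mc_factor_weq_fib i.
have [|h [h1 h2]] := H _ _ p fp wp j (idm b); first by rewrite comp_idl.
apply: (proj2 (proj2 (mc_retract (f := i) (g := j) _))) cj.
by exists (idm a), (idm a), h, p; rewrite !comp_idl !comp_idr.
Qed.

Lemma fib_comp (M : ModelCategory) (x y z : M) (q : Hom y z) (p : Hom x y) :
  Fib q -> Fib p -> Fib (q ∘ p).
Proof.
move=> fq fp; apply: fib_of_lifts => a b i ci wi u v e.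
have [|h [h1 h2]] := mc_lift ci fq (or_introl wi) (u := p ∘ u) (v := v).
  by rewrite comp_assoc.
have [k [k1 k2]] := mc_lift ci fp (or_introl wi) (esym h1).
by exists k; rewrite -comp_assoc k2.
Qed.

Lemma cof_comp (M : ModelCategory) (a b c : M) (j : Hom b c) (i : Hom a b) :
  Cof j -> Cof i -> Cof (j ∘ i).
Proof.
move=> cj ci; apply: cof_of_lifts => x y p fp wp u v e.
have [|h [h1 h2]] := mc_lift ci fp (or_intror wp) (u := u) (v := v ∘ j).
  by rewrite -comp_assoc.
have [k [k1 k2]] := mc_lift cj fp (or_intror wp) h2.
by exists k; rewrite comp_assoc k1.
Qed.

Lemma binary_coproduct (M : ModelCategory) (a b : M) :
  exists (c : M) (i : Hom a c) (j : Hom b c),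
    (forall (X : M) (u : Hom a X) (v : Hom b X), exists w, w ∘ i = u /\ w ∘ j = v) /\
    (forall (X : M) (w w' : Hom c X), w ∘ i = w' ∘ i -> w ∘ j = w' ∘ j -> w = w').
Proof.
have fb : FinFun.Finite bool by exists (true :: false :: nil)%list; case=> /=; auto.
pose L := mc_colim (discrete_functor (fun t : bool => if t then a else b))
  (discrete_finite fb).
exists L, (colim_inj L true), (colim_inj L false); split=> [X u v|X w w' e1 e2]; last first.
  by apply: (colim_ext L); case.
pose c (t : Discrete bool) :=
  match t return Hom (if t then a else b) X with true => u | false => v end.
have H i j (h : @Hom (Discrete bool) i j) :
    c j ∘ fmap (discrete_functor (fun t : bool => if t then a else b)) h = c i.
  by case: j / h; rewrite /= comp_idr.
exists (colim_map L H).
by split; [exact: (colim_map_inj L H true) | exact: (colim_map_inj L H false)].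
Qed.

Lemma binary_product (M : ModelCategory) (Z : ZeroObject M) (a b : M) :
  exists (c : M) (p : Hom c a) (r : Hom c b),
    (forall (X : M) (u : Hom X a) (v : Hom X b), exists w, p ∘ w = u /\ r ∘ w = v) /\
    (forall (X : M) (w w' : Hom X c), p ∘ w = p ∘ w' -> r ∘ w = r ∘ w' -> w = w').
Proof.
exists (pullback (to_zero Z a) (to_zero Z b)), (pb_fst _ _), (pb_snd _ _).
split=> [X u v|X w w']; last exact: pb_ext.
have e : to_zero Z a ∘ u = to_zero Z b ∘ v.
  by rewrite (to_zero_unique (_ ∘ u)) (to_zero_unique (_ ∘ v)).
by exists (pb_pair e); rewrite pb_fst_pair pb_snd_pair.
Qed.

(** * Homotopy classes of maps *)

(** The last clause says that [X + X -> C] is a cofibration. *)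
Record good_cylinder (M : ModelCategory) (X C : M) (i0 i1 : Hom X C) (p : Hom C X) : Prop := {
  gc_0 : p ∘ i0 = idm X;
  gc_1 : p ∘ i1 = idm X;
  gc_weq : Weq p;
  gc_cof0 : Cof i0;
  gc_cof1 : Cof i1;
  gc_lift : forall (A B : M) (r : Hom A B), Fib r -> Weq r ->
    forall (u0 u1 : Hom X A) (v : Hom C B), r ∘ u0 = v ∘ i0 -> r ∘ u1 = v ∘ i1 ->
    exists h : Hom C A, h ∘ i0 = u0 /\ h ∘ i1 = u1 /\ r ∘ h = v
}.

(** [gp_lift] says, without choosing a product, that [(d0, d1) : P -> Y x Y] is a fibration. *)
Record good_path (M : ModelCategory) (Y P : M) (d0 d1 : Hom P Y) (s : Hom Y P) : Prop := {
  gp_0 : d0 ∘ s = idm Y;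
  gp_1 : d1 ∘ s = idm Y;
  gp_weq : Weq s;
  gp_lift : forall (A B : M) (i : Hom A B), Cof i -> Weq i ->
    forall (u : Hom A P) (v0 v1 : Hom B Y), d0 ∘ u = v0 ∘ i -> d1 ∘ u = v1 ∘ i ->
    exists h : Hom B P, h ∘ i = u /\ d0 ∘ h = v0 /\ d1 ∘ h = v1
}.

(** Factor [X + X -> Cyl] as a cofibration followed by an acyclic fibration [c], along which
    homotopies on [Cyl] are pulled back. The inclusions [X -> X + X] are cofibrations, being cobase
    changes of [0 -> X]. *)
Lemma refine_cylinder (M : ModelCategory) (Z : ZeroObject M) (X Cyl : M)
    (j0 j1 : Hom X Cyl) (p : Hom Cyl X) :
  cofibrant Z X -> Weq p -> p ∘ j0 = idm X -> p ∘ j1 = idm X ->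
  exists (C : M) (i0 i1 : Hom X C) (c : Hom C Cyl),
    good_cylinder i0 i1 (p ∘ c) /\ c ∘ i0 = j0 /\ c ∘ i1 = j1.
Proof.
move=> cX wp e0 e1.
have [S [a [b [ex un]]]] := binary_coproduct X X.
have [j [ja jb]] := ex _ j0 j1.
have [C [i [c [ci [fc [wc ej]]]]]] := mc_factor_weq_fib j.
have c0 : c ∘ (i ∘ a) = j0 by rewrite comp_assoc ej.
have c1 : c ∘ (i ∘ b) = j1 by rewrite comp_assoc ej.
exists C, (i ∘ a), (i ∘ b), c; do 2 (split=> //).
- by rewrite -comp_assoc c0.
- by rewrite -comp_assoc c1.
- exact: (proj1 (mc_two_of_three p c)).
- apply: cof_comp => //; apply: cof_of_lifts => x y r fr wr u v e.
  have [|h [_ h2]] := mc_lift cX fr (or_intror wr) (u := from_zero Z x) (v := v ∘ b).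
    by rewrite (from_zero_unique (r ∘ _)) (from_zero_unique (_ ∘ from_zero Z X)).
  have [w [wa wb]] := ex _ u h; exists w; split=> //.
  by apply: un; rewrite -comp_assoc ?wa ?wb.
- apply: cof_comp => //; apply: cof_of_lifts => x y r fr wr u v e.
  have [|h [_ h2]] := mc_lift cX fr (or_intror wr) (u := from_zero Z x) (v := v ∘ a).
    by rewrite (from_zero_unique (r ∘ _)) (from_zero_unique (_ ∘ from_zero Z X)).
  have [w [wa wb]] := ex _ h u; exists w; split=> //.
  by apply: un; rewrite -comp_assoc ?wa ?wb.
- move=> A B r fr wr u0 u1 v h0 h1; have [w [wa wb]] := ex _ u0 u1.
  have [|h [hi hr]] := mc_lift ci fr (or_intror wr) (u := w) (v := v).
    by apply: un; rewrite -!comp_assoc ?wa ?wb.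
  by exists h; rewrite !comp_assoc hi.
Qed.

Lemma refine_path (M : ModelCategory) (Z : ZeroObject M) (Y Path : M)
    (e0 e1 : Hom Path Y) (s : Hom Y Path) :
  Weq s -> e0 ∘ s = idm Y -> e1 ∘ s = idm Y ->
  exists (P : M) (d0 d1 : Hom P Y) (c : Hom Path P),
    good_path d0 d1 (c ∘ s) /\ d0 ∘ c = e0 /\ d1 ∘ c = e1.
Proof.
move=> ws h0 h1.
have [T [a [b [ex un]]]] := binary_product Z Y Y.
have [j [ja jb]] := ex _ e0 e1.
have [P [c [d [cc [wc [fd ej]]]]]] := mc_factor_weq_cof j.
have c0 : a ∘ d ∘ c = e0 by rewrite -comp_assoc ej.
have c1 : b ∘ d ∘ c = e1 by rewrite -comp_assoc ej.
exists P, (a ∘ d), (b ∘ d), c; do 2 (split=> //).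
- by rewrite comp_assoc c0.
- by rewrite comp_assoc c1.
- exact: (proj1 (mc_two_of_three c s)).
- move=> A B i ci wi u v0 v1 u0 u1; have [w [wa wb]] := ex _ v0 v1.
  have [|h [hi hd]] := mc_lift ci fd (or_introl wi) (u := u) (v := w).
    by apply: un; rewrite !comp_assoc ?wa ?wb.
  by exists h; rewrite -!comp_assoc hd.
Qed.

(** [d1] is [P -> Y x Y] followed by a base change of [Y -> 0]. In terms of lifting, fibrancy of [Y]
    first extends [d0 u] over [b]. *)
Lemma good_path_fib (M : ModelCategory) (Z : ZeroObject M) (Y P : M)
    (d0 d1 : Hom P Y) (s : Hom Y P) :
  fibrant Z Y -> good_path d0 d1 s -> Fib d1.
Proof.
move=> fY gp; apply: fib_of_lifts => a b i ci wi u v e.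
have [|h [h1 _]] := mc_lift ci fY (or_introl wi) (u := d0 ∘ u) (v := to_zero Z b).
  by rewrite (to_zero_unique (to_zero Z Y ∘ _)) (to_zero_unique (_ ∘ i)).
by have [k [k1 [_ k2]]] := gp_lift gp ci wi (esym h1) e; exists k.
Qed.

(** Lift [(H, h p) : C -> Y x Y] to [P] along [i1], starting with the path [K]. *)
Lemma cylinder_then_path (M : ModelCategory) (X Y C P : M)
    (i0 i1 : Hom X C) (p : Hom C X) (d0 d1 : Hom P Y) (s : Hom Y P)
    (H : Hom C Y) (K : Hom X P) :
  good_cylinder i0 i1 p -> good_path d0 d1 s -> H ∘ i1 = d0 ∘ K ->
  exists K' : Hom X P, d0 ∘ K' = H ∘ i0 /\ d1 ∘ K' = d1 ∘ K.
Proof.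
move=> gc gp e.
have wi : Weq i1 := proj1 (weq_retraction (gc_1 gc)) (gc_weq gc).
have [||L [_ [L0 L1]]] := gp_lift gp (gc_cof1 gc) wi (u := K) (v0 := H) (v1 := d1 ∘ K ∘ p).
  by rewrite e.
  by rewrite -(comp_assoc (d1 ∘ K)) (gc_1 gc) comp_idr.
by exists (L ∘ i0); rewrite !comp_assoc L0 L1 -(comp_assoc (d1 ∘ K)) (gc_0 gc) comp_idr.
Qed.

(** Lift [H] along the acyclic fibration [d1] with ends [K] and a constant path. *)
Lemma path_then_cylinder (M : ModelCategory) (Z : ZeroObject M) (X Y C P : M)
    (i0 i1 : Hom X C) (p : Hom C X) (d0 d1 : Hom P Y) (s : Hom Y P)
    (H : Hom C Y) (K : Hom X P) :
  fibrant Z Y -> good_cylinder i0 i1 p -> good_path d0 d1 s -> H ∘ i0 = d1 ∘ K ->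
  exists H' : Hom C Y, H' ∘ i0 = d0 ∘ K /\ H' ∘ i1 = H ∘ i1.
Proof.
move=> fY gc gp e.
have wd : Weq d1 := proj2 (weq_retraction (gp_1 gp)) (gp_weq gp).
have [||L [L0 [L1 _]]] := gc_lift gc (good_path_fib fY gp) wd (u0 := K)
  (u1 := s ∘ (H ∘ i1)) (v := H).
  by rewrite e.
  by rewrite comp_assoc (gp_1 gp) comp_idl.
exists (d0 ∘ L); rewrite -!comp_assoc L0 L1; split=> //.
by rewrite comp_assoc (gp_0 gp) comp_idl.
Qed.

Lemma exists_good_cylinder (M : ModelCategory) (Z : ZeroObject M) (X : M) :
  cofibrant Z X -> exists (C : M) (i0 i1 : Hom X C) (p : Hom C X), good_cylinder i0 i1 p.
Proof.
move=> cX.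
have [C [i0 [i1 [c [gc _]]]]] := refine_cylinder cX (weq_id X) (comp_idl _) (comp_idl _).
by exists C, i0, i1, (idm X ∘ c).
Qed.

Lemma exists_good_path (M : ModelCategory) (Z : ZeroObject M) (Y : M) :
  exists (P : M) (d0 d1 : Hom P Y) (s : Hom Y P), good_path d0 d1 s.
Proof.
have [P [d0 [d1 [c [gp _]]]]] := refine_path Z (weq_id Y) (comp_idl _) (comp_idl _).
by exists P, d0, d1, (c ∘ idm Y).
Qed.

Lemma left_homotopic_good (M : ModelCategory) (Z : ZeroObject M) (X Y : M) (f g : Hom X Y) :
  cofibrant Z X -> left_homotopic f g ->
  exists (C : M) (i0 i1 : Hom X C) (p : Hom C X) (H : Hom C Y),
    good_cylinder i0 i1 p /\ H ∘ i0 = f /\ H ∘ i1 = g.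
Proof.
move=> cX [Cyl [j0 [j1 [p [H [wp [p0 [p1 [H0 H1]]]]]]]]].
have [C [i0 [i1 [c [gc [c0 c1]]]]]] := refine_cylinder cX wp p0 p1.
by exists C, i0, i1, (p ∘ c), (H ∘ c); rewrite -!comp_assoc c0 c1.
Qed.

Lemma good_left_homotopic (M : ModelCategory) (X Y C : M) (i0 i1 : Hom X C) (p : Hom C X)
    (H : Hom C Y) :
  good_cylinder i0 i1 p -> left_homotopic (H ∘ i0) (H ∘ i1).
Proof.
move=> gc; exists C, i0, i1, p, H.
by rewrite (gc_0 gc) (gc_1 gc); split=> //; exact: gc_weq gc.
Qed.

Lemma left_homotopic_sym (M : ModelCategory) (X Y : M) (f g : Hom X Y) :
  left_homotopic f g -> left_homotopic g f.
Proof.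
move=> [C [i0 [i1 [p [H [wp [p0 [p1 [H0 H1]]]]]]]]].
by exists C, i1, i0, p, H.
Qed.

Lemma left_homotopic_refl (M : ModelCategory) (X Y : M) (f : Hom X Y) : left_homotopic f f.
Proof.
by exists X, (idm X), (idm X), (idm X), f; rewrite !comp_idl comp_idr; split=> //; apply: weq_id.
Qed.

Lemma left_homotopic_comp (M : ModelCategory) (X Y W : M) (h : Hom Y W) (f g : Hom X Y) :
  left_homotopic f g -> left_homotopic (h ∘ f) (h ∘ g).
Proof.
move=> [C [i0 [i1 [p [H [wp [p0 [p1 [H0 H1]]]]]]]]].
by exists C, i0, i1, p, (h ∘ H); rewrite -!comp_assoc H0 H1.
Qed.

Lemma right_homotopic_comp (M : ModelCategory) (X Y W : M) (h : Hom W X) (f g : Hom X Y) :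
  right_homotopic f g -> right_homotopic (f ∘ h) (g ∘ h).
Proof.
move=> [P [d0 [d1 [s [K [ws [s0 [s1 [K0 K1]]]]]]]]].
by exists P, d0, d1, s, (K ∘ h); rewrite !comp_assoc K0 K1.
Qed.

(** [cylinder_then_path] absorbs the left homotopy into the right one, so that no cylinders have to
    be glued. For [g = h] this turns left homotopies into right ones. *)
Lemma left_right_homotopic_trans (M : ModelCategory) (Z : ZeroObject M) (X Y : M)
    (f g h : Hom X Y) :
  cofibrant Z X -> left_homotopic f g -> right_homotopic g h -> right_homotopic f h.
Proof.
move=> cX /(left_homotopic_good cX) [C [i0 [i1 [p [H [gc [H0 H1]]]]]]].
move=> [Path [e0 [e1 [s [K [ws [s0 [s1 [K0 K1]]]]]]]]].
have [P [d0 [d1 [c [gp [c0 c1]]]]]] := refine_path Z ws s0 s1.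
have [|K' [K'0 K'1]] := cylinder_then_path (H := H) (K := c ∘ K) gc gp.
  by rewrite comp_assoc c0 K0.
exists P, d0, d1, (c ∘ s), K'; split; first exact: gp_weq gp.
by rewrite (gp_0 gp) (gp_1 gp) K'0 K'1 comp_assoc c1.
Qed.

Lemma right_homotopic_refl (M : ModelCategory) (X Y : M) (f : Hom X Y) : right_homotopic f f.
Proof.
by exists Y, (idm Y), (idm Y), (idm Y), f; rewrite !comp_idl; split=> //; apply: weq_id.
Qed.

Lemma left_right_homotopic (M : ModelCategory) (Z : ZeroObject M) (X Y : M) (f g : Hom X Y) :
  cofibrant Z X -> left_homotopic f g -> right_homotopic f g.
Proof. by move=> cX h; exact: left_right_homotopic_trans cX h (right_homotopic_refl g). Qed.

(** The cylinder is prescribed, so that homotopies between the components of two maps into a product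
    can be taken on a single cylinder and assembled. *)
Lemma right_homotopic_cylinder (M : ModelCategory) (Z : ZeroObject M) (X Y C : M)
    (i0 i1 : Hom X C) (p : Hom C X) (f g : Hom X Y) :
  fibrant Z Y -> good_cylinder i0 i1 p -> right_homotopic f g ->
  exists H : Hom C Y, H ∘ i0 = f /\ H ∘ i1 = g.
Proof.
move=> fY gc [Path [e0 [e1 [s [K [ws [s0 [s1 [K0 K1]]]]]]]]].
have [P [d0 [d1 [c [gp [c0 c1]]]]]] := refine_path Z ws s0 s1.
(* [g p] is the constant homotopy at [g]. *)
have [|H [H0 H1]] := path_then_cylinder (H := g ∘ p) (K := c ∘ K) fY gc gp.
  by rewrite comp_assoc c1 K1 -comp_assoc (gc_0 gc) comp_idr.
by exists H; rewrite H0 H1 comp_assoc c0 -comp_assoc (gc_1 gc) comp_idr.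
Qed.

Lemma right_left_homotopic (M : ModelCategory) (Z : ZeroObject M) (X Y : M) (f g : Hom X Y) :
  cofibrant Z X -> fibrant Z Y -> right_homotopic f g -> left_homotopic f g.
Proof.
move=> cX fY h; have [C [i0 [i1 [p gc]]]] := exists_good_cylinder cX.
have [H [<- <-]] := right_homotopic_cylinder fY gc h.
exact: good_left_homotopic gc.
Qed.

Lemma left_homotopic_trans (M : ModelCategory) (Z : ZeroObject M) (X Y : M)
    (f g h : Hom X Y) :
  cofibrant Z X -> fibrant Z Y -> left_homotopic f g -> left_homotopic g h ->
  left_homotopic f h.
Proof.
move=> cX fY fg gh; apply: (right_left_homotopic cX fY).
exact: left_right_homotopic_trans cX fg (left_right_homotopic cX gh).
Qed.

(** The constant path at [F i] extends along [i] to a path from [F] to [G]. *)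
Lemma right_homotopic_of_acyclic_cof (M : ModelCategory) (Z : ZeroObject M) (A B W : M) (i : Hom A B)
    (F G : Hom B W) :
  Cof i -> Weq i -> F ∘ i = G ∘ i -> right_homotopic F G.
Proof.
move=> ci wi e; have [P [d0 [d1 [s gp]]]] := exists_good_path Z W.
have [||h [_ [h0 h1]]] := gp_lift gp ci wi (u := s ∘ (F ∘ i)) (v0 := F) (v1 := G).
  by rewrite comp_assoc (gp_0 gp) comp_idl.
  by rewrite comp_assoc (gp_1 gp) comp_idl.
exists P, d0, d1, s, h; split; first exact: gp_weq gp.
by rewrite (gp_0 gp) (gp_1 gp).
Qed.

(** Factor [w] as an acyclic cofibration [i], which has a homotopy inverse [r],
    followed by an acyclic fibration [p]. *)
Lemma weq_fibrant_factor (M : ModelCategory) (Z : ZeroObject M) (W W' : M) (w : Hom W W') :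
  fibrant Z W -> fibrant Z W' -> Weq w ->
  exists (V : M) (i : Hom W V) (p : Hom V W') (r : Hom V W),
    p ∘ i = w /\ Fib p /\ Weq p /\ fibrant Z V /\ r ∘ i = idm W /\
    right_homotopic (i ∘ r) (idm V).
Proof.
move=> fW fW' ww; have [V [i [p [ci [wi [fp e]]]]]] := mc_factor_weq_cof w.
have [|r [r1 _]] := mc_lift ci fW (or_introl wi) (u := idm W) (v := to_zero Z V).
  by rewrite (to_zero_unique (_ ∘ idm W)) (to_zero_unique (_ ∘ i)).
have wp : Weq p.
  by apply: (proj1 (proj2 (mc_two_of_three p i))) => //; rewrite e.
exists V, i, p, r; do 3 (split=> //); split.
  by rewrite /fibrant -(to_zero_unique (to_zero Z W' ∘ p)); apply: fib_comp.
split=> //; apply: (right_homotopic_of_acyclic_cof Z ci wi).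
by rewrite -comp_assoc r1 comp_idl comp_idr.
Qed.

(** Lift [b] strictly through the acyclic fibration [p], then apply the homotopy inverse [r] of
    [i]. *)
Lemma weq_homotopy_surj (M : ModelCategory) (Z : ZeroObject M) (X W W' : M) (w : Hom W W')
    (b : Hom X W') :
  cofibrant Z X -> fibrant Z W -> fibrant Z W' -> Weq w ->
  exists a : Hom X W, left_homotopic (w ∘ a) b.
Proof.
move=> cX fW fW' ww.
have [V [i [p [r [e [fp [wp [fV [ri hr]]]]]]]]] := weq_fibrant_factor fW fW' ww.
have [|b' [_ eb]] := mc_lift cX fp (or_intror wp) (u := from_zero Z V) (v := b).
  by rewrite (from_zero_unique (p ∘ _)) (from_zero_unique (b ∘ _)).
exists (r ∘ b'); rewrite -e -eb -comp_assoc; apply: left_homotopic_comp.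
apply: (right_left_homotopic cX fV); rewrite comp_assoc -{2}(comp_idl b').
exact: right_homotopic_comp.
Qed.

(** The homotopy lifts through [p] to one from [i a] to [i a'], and [r] is a strict left inverse of
    [i]. *)
Lemma weq_homotopy_inj (M : ModelCategory) (Z : ZeroObject M) (X W W' : M) (w : Hom W W')
    (a a' : Hom X W) :
  cofibrant Z X -> fibrant Z W -> fibrant Z W' -> Weq w ->
  left_homotopic (w ∘ a) (w ∘ a') -> left_homotopic a a'.
Proof.
move=> cX fW fW' ww.
have [V [i [p [r [e [fp [wp [fV [ri hr]]]]]]]]] := weq_fibrant_factor fW fW' ww.
move=> /(left_homotopic_good cX) [C [i0 [i1 [c [H [gc [H0 H1]]]]]]].
have [||h [h0 [h1 _]]] := gc_lift gc fp wp (u0 := i ∘ a) (u1 := i ∘ a') (v := H).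
  by rewrite comp_assoc e.
  by rewrite comp_assoc e.
have := left_homotopic_comp r (good_left_homotopic h gc).
by rewrite h0 h1 !comp_assoc ri !comp_idl.
Qed.

(** * Fibrant replacement and the action of zigzags on homotopy classes *)

Lemma exists_fibrant_replacement (M : ModelCategory) (Z : ZeroObject M) (Y : M) :
  exists R : {W : M & Hom Y W},
    Cof (projT2 R) /\ Weq (projT2 R) /\ fibrant Z (projT1 R).
Proof.
have [W [i [p [ci [wi [fp e]]]]]] := mc_factor_weq_cof (to_zero Z Y).
exists (existT _ W i); do 2 split=> //.
by rewrite /fibrant -(to_zero_unique p).
Qed.

Section FibrantReplacement.
Context (M : ModelCategory) (Z : ZeroObject M).

Definition fibrant_replacement (Y : M) : {W : M & Hom Y W} :=
  proj1_sig (constructive_indefinite_description _ (exists_fibrant_replacement Z Y)).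

Local Notation R Y := (projT1 (fibrant_replacement Y)).
Local Notation r Y := (projT2 (fibrant_replacement Y)).

Lemma fibrant_replacement_spec (Y : M) : Cof (r Y) /\ Weq (r Y) /\ fibrant Z (R Y).
Proof.
exact: (proj2_sig (constructive_indefinite_description _
  (exists_fibrant_replacement Z Y))).
Qed.

Lemma fibrant_replacement_map_exists (Y Y' : M) (f : Hom Y Y') :
  exists F : Hom (R Y) (R Y'), F ∘ r Y = r Y' ∘ f.
Proof.
have [ci [wi _]] := fibrant_replacement_spec Y.
have [_ [_ fY']] := fibrant_replacement_spec Y'.
have [|F [e _]] := mc_lift ci fY' (or_introl wi) (u := r Y' ∘ f) (v := to_zero Z (R Y)).
  by rewrite (to_zero_unique (_ ∘ r Y)) (to_zero_unique (_ ∘ (r Y' ∘ f))).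
by exists F.
Qed.

Definition fibrant_replacement_map (Y Y' : M) (f : Hom Y Y') : Hom (R Y) (R Y') :=
  proj1_sig (constructive_indefinite_description _ (fibrant_replacement_map_exists f)).

Local Notation Rmap := fibrant_replacement_map.

Lemma fibrant_replacement_mapE (Y Y' : M) (f : Hom Y Y') : Rmap f ∘ r Y = r Y' ∘ f.
Proof.
exact: (proj2_sig (constructive_indefinite_description _
  (fibrant_replacement_map_exists f))).
Qed.

Lemma fibrant_replacement_map_weq (Y Y' : M) (w : Hom Y Y') : Weq w -> Weq (Rmap w).
Proof.
move=> ww; have [_ [wY _]] := fibrant_replacement_spec Y.
have [_ [wY' _]] := fibrant_replacement_spec Y'.
apply: (proj1 (proj2 (mc_two_of_three (Rmap w) (r Y)))) => //.
by rewrite fibrant_replacement_mapE; apply: (proj1 (mc_two_of_three _ _)).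
Qed.

Lemma fibrant_replacement_lift_exists (X Y Y' : M) (cX : cofibrant Z X) (w : Hom Y Y')
    (ww : Weq w) (b : Hom X (R Y')) :
  exists a : Hom X (R Y), left_homotopic (Rmap w ∘ a) b.
Proof.
have [_ [_ fY]] := fibrant_replacement_spec Y.
have [_ [_ fY']] := fibrant_replacement_spec Y'.
exact: weq_homotopy_surj b cX fY fY' (fibrant_replacement_map_weq ww).
Qed.

Definition fibrant_replacement_lift (X Y Y' : M) (cX : cofibrant Z X) (w : Hom Y Y')
    (ww : Weq w) (b : Hom X (R Y')) : Hom X (R Y) :=
  proj1_sig (constructive_indefinite_description _ (fibrant_replacement_lift_exists cX ww b)).

Lemma fibrant_replacement_liftE (X Y Y' : M) (cX : cofibrant Z X) (w : Hom Y Y')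
    (ww : Weq w) (b : Hom X (R Y')) :
  left_homotopic (Rmap w ∘ fibrant_replacement_lift cX ww b) b.
Proof.
exact: (proj2_sig (constructive_indefinite_description _
  (fibrant_replacement_lift_exists cX ww b))).
Qed.

#[local] Set Asymmetric Patterns.
(** A backward step applies a chosen preimage under [Rmap w] up to homotopy, so only the homotopy
    class of the value is meaningful. *)
Fixpoint zz_rep (X : M) (cX : cofibrant Z X) (Y : M) (z : zigzag X Y) : Hom X (R Y) :=
  match z in zigzag _ Y' return Hom X (R Y') with
  | zz_nil => r X
  | zz_fwd _ _ z f => Rmap f ∘ zz_rep cX z
  | zz_bwd _ _ z w ww => fibrant_replacement_lift cX ww (zz_rep cX z)
  end.

Lemma zz_rep_eq (X Y : M) (cX : cofibrant Z X) (z z' : zigzag X Y) :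
  zz_eq z z' -> left_homotopic (zz_rep cX z) (zz_rep cX z').
Proof.
have fR T : fibrant Z (R T) by case: (fibrant_replacement_spec T) => _ [].
(* Maps out of [R T] are determined up to homotopy on [T]; hence [Rmap] respects identities and
   composites up to homotopy. *)
have unique (T T' : M) (F G : Hom (R T) (R T')) (a : Hom X (R T)) :
    F ∘ r T = G ∘ r T -> left_homotopic (F ∘ a) (G ∘ a).
  move=> e; apply: (right_left_homotopic cX (fR _)); apply: right_homotopic_comp.
  have [ci [wi _]] := fibrant_replacement_spec T.
  exact: (right_homotopic_of_acyclic_cof Z ci wi).
(* The value of a backward step is known only after [Rmap w], which is cancelled here. *)
have inj T T' (w : Hom T T') (a a' : Hom X (R T)) : Weq w ->
    left_homotopic (Rmap w ∘ a) (Rmap w ∘ a') -> left_homotopic a a'.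
  move=> ww; exact: (weq_homotopy_inj cX (fR _) (fR _) (fibrant_replacement_map_weq ww)).
elim=> {z z'} /=.
- by move=> *; apply: left_homotopic_refl.
- by move=> *; apply: left_homotopic_sym.
- move=> T z1 z2 z3 _ h1 _ h2; exact: (left_homotopic_trans cX (fR _) h1 h2).
- by move=> *; apply: left_homotopic_comp.
- move=> T T' z z' w ww _ h; apply: (inj _ _ w _ _ ww).
  apply: (left_homotopic_trans cX (fR _) (fibrant_replacement_liftE _ _ _)).
  apply: (left_homotopic_trans cX (fR _) h).
  exact/left_homotopic_sym/fibrant_replacement_liftE.
- move=> T z; rewrite -{2}(comp_idl (zz_rep cX z)); apply: unique.
  by rewrite fibrant_replacement_mapE comp_idl comp_idr.
- move=> T T' T'' z f g; rewrite comp_assoc; apply: unique.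
  by rewrite -comp_assoc !fibrant_replacement_mapE !comp_assoc fibrant_replacement_mapE.
- by move=> T T' z w ww; apply: fibrant_replacement_liftE.
- move=> T T' z w ww; apply: (inj _ _ w _ _ ww).
  exact: fibrant_replacement_liftE.
Qed.
End FibrantReplacement.

(** The one-step zigzags [f] and [g] are represented by [f] and [g] followed by the replacement map
    of [Y], a weak equivalence between fibrant objects, which can be cancelled. *)
Lemma homotopic_of_ho_eq (M : ModelCategory) (Z : ZeroObject M) (X Y : M) (f g : Hom X Y) :
  cofibrant Z X -> fibrant Z Y -> fmap to_ho f = fmap to_ho g -> left_homotopic f g.
Proof.
move=> cX fY /ho_class_eq /(zz_rep_eq cX) /=.
rewrite !fibrant_replacement_mapE.
have [_ [wY fRY]] := fibrant_replacement_spec Z Y.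
exact: (weq_homotopy_inj cX fY fRY wY).
Qed.

(** [i0] and [i1] are sections of [p], which is invertible in [ho M], so they have the same image
    there. *)
Lemma ho_eq_of_homotopic (M : ModelCategory) (X Y : M) (f g : Hom X Y) :
  left_homotopic f g -> fmap to_ho f = fmap to_ho g.
Proof.
move=> [C [i0 [i1 [p [H [wp [p0 [p1 [<- <-]]]]]]]]].
pose v : @Hom (ho M) X C := ho_class (zz_bwd (zz_nil X) wp).
have vp : v ∘ fmap to_ho p = idm (C : ho M).
  rewrite /v /= ho_comp_class; apply/ho_class_eq; exact: zz_fwd_bwd.
rewrite !fmap_comp; congr (_ ∘ _).
by rewrite -(comp_idl (fmap to_ho i0)) -(comp_idl (fmap to_ho i1)) -vp
  -!comp_assoc -!fmap_comp p0 p1.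
Qed.

(** * Maps into reduced matching objects, and degrees of morphisms *)

Section ReducedMatching.
Context (M : ModelCategory) (Z : ZeroObject M) (J : PointedWeakLattice).
Context (P : J -> Prop) (Y : Functor (Full P) M).
Context (s : J) (j : nat) (below : forall u : Under s j, P (tgt u)).

Definition reduced_matching_proj (u : Under s j) :
    Hom (reduced_matching Z Y below) (at_under Y below u) :=
  lim_proj (matching Y below) u ∘ pb_fst (matching_incl Y below) (Theta Z Y below).

(** [Theta] is a split monomorphism, each factor of the reduced product being a factor of the full
    one, and [pb_fst] is a base change of it. *)
Lemma reduced_matching_ext_fst (X : M) (f g : Hom X (reduced_matching Z Y below)) :
  pb_fst (matching_incl Y below) (Theta Z Y below) ∘ f =
  pb_fst (matching_incl Y below) (Theta Z Y below) ∘ g -> f = g.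
Proof.
move=> e; apply: pb_ext => //; apply: product_ext => r.
have T : proj (runder_finite s j) (fun r => at_under Y below (proj1_sig r)) r =
    proj (under_finite s j) (at_under Y below) (proj1_sig r) ∘ Theta Z Y below.
  rewrite /Theta proj_tuple /Theta_component.
  case: r => u nz /=; case: bool_dec => // nz'.
  by rewrite (proof_irrelevance _ nz nz').
by rewrite T -!comp_assoc; congr (_ ∘ _); rewrite !comp_assoc -pb_square -!comp_assoc e.
Qed.

Lemma reduced_matching_ext (X : M) (f g : Hom X (reduced_matching Z Y below)) :
  (forall u, reduced_matching_proj u ∘ f = reduced_matching_proj u ∘ g) -> f = g.
Proof.
move=> e; apply: reduced_matching_ext_fst; apply: (lim_ext (matching Y below)) => u.
by rewrite !comp_assoc; exact: e.
Qed.

(** The projections of a limit are jointly monic, so [matching_incl] is a monomorphism, and [forget]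
    is its base change. *)
Lemma forget_mono (X : M) (f g : Hom X (reduced_matching Z Y below)) :
  forget Z Y below ∘ f = forget Z Y below ∘ g -> f = g.
Proof.
move=> e; apply: reduced_matching_ext => u; rewrite /reduced_matching_proj.
have T : lim_proj (matching Y below) u =
    proj (under_finite s j) (at_under Y below) u ∘ matching_incl Y below.
  by rewrite /matching_incl proj_tuple.
rewrite T -!comp_assoc; congr (_ ∘ _); rewrite !comp_assoc pb_square -!comp_assoc.
by congr (_ ∘ _).
Qed.

Lemma reduced_matching_proj_map (X : M) (c : forall u : Under s j, Hom X (at_under Y below u))
    (c_nat : forall (u v : under_cat s j) (h : Hom u v),
      fmap (fcompose Y (under_incl below)) h ∘ c u = c v)
    (c_null : forall u, null (arr u) = true -> c u = zero_map Z X (at_under Y below u))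
    (u : Under s j) :
  reduced_matching_proj u ∘ reduced_matching_map c_nat c_null = c u.
Proof.
rewrite /reduced_matching_proj -comp_assoc pb_fst_pair.
exact: (lim_map_proj (matching Y below)).
Qed.
End ReducedMatching.

Lemma deg_hom (J : WeakLattice) (s t : J) (f : Hom s t) : s = t \/ deg t < deg s.
Proof.
case: (classic (is_identity f)) => [|nf]; last by right; apply: wl_deg_decr nf.
by case; left.
Qed.

Lemma endo_id (J : WeakLattice) (s : J) (f : Hom s s) : f = idm s.
Proof.
case: (classic (is_identity f)) => [i|/wl_deg_decr]; last by lia.
(* Freeing the endpoints and transporting along [e] permits case analysis on [is_identity]; proof
   irrelevance then removes the transport. *)
have H (a b : J) (h : Hom a b) : is_identity h ->
    forall e : a = b, h = match e in _ = b' return Hom a b' with eq_refl => idm a end.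
  by case=> c e; rewrite (proof_irrelevance _ e eq_refl).
exact: (H _ _ _ i eq_refl).
Qed.

(** * Extensions of the two lifts *)

Lemma comp_square (C : Category) (X A B B' D T : C) (b : Hom B D) (c : Hom A B)
    (m : Hom B' D) (n : Hom A B') (a : Hom D T) (l : Hom B' T) :
  b ∘ c = m ∘ n -> a ∘ m = l -> forall d : Hom X A, a ∘ (b ∘ (c ∘ d)) = l ∘ (n ∘ d).
Proof. by move=> e <- d; rewrite (comp_assoc b) e -!comp_assoc. Qed.

Lemma lift_map_irrelevance (M : ModelCategory) (J : PointedWeakLattice) (Yt : Functor J (ho M))
    (P : J -> Prop) (Y : Lift (restrict Yt P)) (s t : J) (hs hs' : P s) (ht ht' : P t)
    (f : Hom s t) :
  lift_map Y (s := exist P s hs) (t := exist P t ht) f =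
  lift_map Y (s := exist P s hs') (t := exist P t ht') f :> Hom (val Yt s) (val Yt t).
Proof. by rewrite (proof_irrelevance _ hs hs') (proof_irrelevance _ ht ht'). Qed.

Section Extension.
Context (M : ModelCategory) (Z : ZeroObject M) (J : PointedWeakLattice).
Context (Yt : Functor J (ho M)).
Context (x : J) (k : nat) (hk : k < deg x) (k_gt0 : 0 < k).
Context (Yk : Lift (restrict Yt (boundary_obj x k))) (Yk_pt : pointed_functor Z Yk).
Context (Yx : Lift (restrict Yt (truncated_obj x (k - 1)))) (Yx_pt : pointed_functor Z Yx).
Context (agree :
  restrict_lift (boundary_mono (Nat.le_sub_l k 1)) Yk =
  restrict_lift (@truncated_boundary J x (k - 1)) Yx).

Local Notation sproj g :=
  (proj (runder_eq_finite x k) (fun r => val Yt (tgt (proj1_sig r))) g).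

Definition compatible (sigma : Hom (val Yt x) (prod_eq Yt x k)) : Prop :=
  forall (g : RUnderEq x k) (u : Under (tgt (proj1_sig g)) (k - 1)),
    lift_map Yk (s := obj_g hk g) (t := exist _ (tgt u) (below_g hk u)) (arr u) ∘
      (sproj g ∘ sigma) = Yx_at Yx (under_comp u).

Lemma proj_alpha (g : RUnderEq x k) :
  proj (runder_eq_finite x k) (fun g => Mbar Z hk Yk g : M) g ∘ alpha hk Yk_pt =
  matching_map Yk_pt (s := obj_g hk g) (below_g hk (g := g)) ∘ sproj g.
Proof.
exact: (proj_tuple (runder_eq_finite x k) (fun g => _ ∘ proj _ _ g)).
Qed.

(** Maps into a product of reduced matching objects are detected by the maps
    [reduced_matching_proj], on which the equation becomes functoriality on the composites
    [x -> s -> v]. *)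
Lemma alpha_zeta (sigma : Hom (val Yt x) (prod_eq Yt x k)) :
  alpha hk Yk_pt ∘ sigma = tuple (runder_eq_finite x k) (zeta hk Yx_pt agree) <->
  compatible sigma.
Proof.
have comp_u g u : reduced_matching_proj Z Yk (below_g hk (g := g)) u ∘
    (proj (runder_eq_finite x k) (fun g => Mbar Z hk Yk g : M) g ∘ (alpha hk Yk_pt ∘ sigma)) =
    lift_map Yk (s := obj_g hk g) (t := exist _ (tgt u) (below_g hk u)) (arr u) ∘
      (sproj g ∘ sigma).
  apply: (comp_square (proj_alpha g) _ sigma).
  exact: reduced_matching_proj_map.
have zeta_u g u : reduced_matching_proj Z Yk (below_g hk (g := g)) u ∘
    (proj (runder_eq_finite x k) (fun g => Mbar Z hk Yk g : M) g ∘
      tuple (runder_eq_finite x k) (zeta hk Yx_pt agree)) = Yx_at Yx (under_comp u).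
  rewrite (proj_tuple (runder_eq_finite x k) (zeta hk Yx_pt agree)).
  exact: reduced_matching_proj_map.
split=> [e g u|c]; first by rewrite -comp_u e zeta_u.
apply: product_ext => g; apply: reduced_matching_ext => u.
by apply: etrans (comp_u g u) _; rewrite c -zeta_u.
Qed.

Lemma truncated_step (t : J) :
  truncated_obj x k t -> deg t <= k - 1 -> truncated_obj x (k - 1) t.
Proof. by case=> h _ d; split=> //; right. Qed.

Lemma not_truncated_deg (t : J) :
  truncated_obj x k t -> ~ truncated_obj x (k - 1) t -> deg t = k.
Proof.
move=> [h [->|d]] n; first by case: n; apply: truncated_self.
case: (le_lt_dec (deg t) (k - 1)) => d'; last by lia.
by case: n; split=> //; right.
Qed.

(** No morphism leads from the boundary back to [x]: degrees do not increase, and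
    [deg s <= k < deg x]. *)
Lemma boundary_tgt (s t : J) (f : Hom s t) :
  truncated_obj x k s -> s <> x -> truncated_obj x k t -> boundary_obj x k t.
Proof.
move=> [_ [//|ds]] sx ht; split=> // e; subst t.
by case: (deg_hom f) => [//|]; lia.
Qed.

Definition runder_eq_mk (t : J) (f : Hom x t) (d : deg t = k) (nf : null f = false) :
    RUnderEq x k :=
  exist _ (MkUnder f (Nat.eq_le_incl _ _ d)) (conj d nf).

Context (sigma : Hom (val Yt x) (prod_eq Yt x k)).

Definition boundary_map (s t : J) (bs : boundary_obj x k s) (bt : boundary_obj x k t)
    (f : Hom s t) : Hom (val Yt s) (val Yt t) :=
  lift_map Yk (s := exist _ s bs) (t := exist _ t bt) f.

Definition truncated_map (s t : J) (hs : truncated_obj x (k - 1) s)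
    (ht : truncated_obj x (k - 1) t) (f : Hom s t) : Hom (val Yt s) (val Yt t) :=
  lift_map Yx (s := exist _ s hs) (t := exist _ t ht) f.

(** The first case includes [t = x], so the identity of [x] is handled by [Yx]. Otherwise
    [deg t = k], and null arrows, which have no factor in [prod_eq], go to zero. *)
Definition top_map (t : J) (ht : truncated_obj x k t) (f : Hom x t) :
    Hom (val Yt x) (val Yt t) :=
  match excluded_middle_informative (truncated_obj x (k - 1) t) with
  | left h => truncated_map (truncated_self x (k - 1)) h f
  | right n =>
    match bool_dec (null f) false with
    | left nf => sproj (runder_eq_mk (not_truncated_deg ht n) nf) ∘ sigma
    | right _ => zero_map Z _ _
    end
  end.

Definition extension_map (s t : J) (hs : truncated_obj x k s) (ht : truncated_obj x k t)
    (f : Hom s t) : Hom (val Yt s) (val Yt t) :=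
  match excluded_middle_informative (x = s) with
  | left e =>
    match e in _ = s' return Hom s' t -> Hom (val Yt s') (val Yt t) with
    | eq_refl => top_map ht
    end f
  | right n =>
    boundary_map (conj hs (not_eq_sym n)) (boundary_tgt f hs (not_eq_sym n) ht) f
  end.

Lemma extension_map_top (t : J) (hx : truncated_obj x k x) (ht : truncated_obj x k t)
    (f : Hom x t) :
  extension_map hx ht f = top_map ht f.
Proof.
rewrite /extension_map; case: excluded_middle_informative => // e.
by rewrite (proof_irrelevance _ e eq_refl).
Qed.

Lemma extension_map_boundary (s t : J) (hs : truncated_obj x k s) (ht : truncated_obj x k t)
    (bs : boundary_obj x k s) (bt : boundary_obj x k t) (f : Hom s t) :
  extension_map hs ht f = boundary_map bs bt f.
Proof.
rewrite /extension_map; case: excluded_middle_informative => [e|n].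
  by case: bs => _ []; rewrite e.
exact: (lift_map_irrelevance Yk).
Qed.

Lemma top_map_truncated (t : J) (ht : truncated_obj x k t) (h : truncated_obj x (k - 1) t)
    (f : Hom x t) :
  top_map ht f = truncated_map (truncated_self x (k - 1)) h f.
Proof.
rewrite /top_map; case: excluded_middle_informative => // h'.
exact: (lift_map_irrelevance Yx).
Qed.

Lemma agree_boundary (s t : J) (bs : boundary_obj x k s) (bt : boundary_obj x k t)
    (hs : truncated_obj x (k - 1) s) (ht : truncated_obj x (k - 1) t) (f : Hom s t) :
  boundary_map bs bt f =
  truncated_map hs ht f.
Proof.
have bs' : boundary_obj x (k - 1) s by split=> //; case: bs.
have bt' : boundary_obj x (k - 1) t by split=> //; case: bt.
have e := f_equal (fun L : Lift (restrict Yt (boundary_obj x (k - 1))) =>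
  lift_map L (s := exist _ s bs') (t := exist _ t bt') f) agree.
apply: etrans (lift_map_irrelevance Yk _ _ _ _ f) (etrans e _).
exact: (lift_map_irrelevance Yx).
Qed.

Lemma top_map_null (t : J) (ht : truncated_obj x k t) (f : Hom x t) :
  null f = true -> top_map ht f = zero_map Z _ _.
Proof.
move=> nf; rewrite /top_map; case: excluded_middle_informative => [h|n].
  exact: (@Yx_pt (top_obj x k) (exist _ t h) f nf).
by case: bool_dec => // ff; rewrite ff in nf.
Qed.

(** If [deg s < k], all maps come from [Yx]. If [deg s = k] and [g] is not an identity, then
    [deg t < k], and the equation is [compatible sigma], or [0 = 0] for null [f]. *)
Lemma top_map_comp (s t : J) (hs : truncated_obj x k s) (ht : truncated_obj x k t)
    (bs : boundary_obj x k s) (bt : boundary_obj x k t) (g : Hom s t) (f : Hom x s) :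
  compatible sigma ->
  top_map ht (g ∘ f) =
  boundary_map bs bt g ∘ top_map hs f.
Proof.
move=> c.
case: (classic (truncated_obj x (k - 1) s)) => [h|n].
  have h' : truncated_obj x (k - 1) t.
    apply: truncated_step => //; case: h => _ [e|d]; first by case: bs.
    by case: (deg_hom g) => [<-|] //; lia.
  rewrite !top_map_truncated (agree_boundary bs bt h h').
  exact: (lift_comp Yx (r := top_obj x k) (s := exist _ s h) (t := exist _ t h')).
have d := not_truncated_deg hs n.
case: (deg_hom g) => [e|dt].
  subst t; rewrite (endo_id g) comp_idl (proof_irrelevance _ bt bs) (proof_irrelevance _ ht hs).
  have -> : boundary_map bs bs (idm s) = idm (val Yt s) := lift_id Yk (exist _ s bs).
  by rewrite comp_idl.
have h' : truncated_obj x (k - 1) t by apply: truncated_step => //; lia.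
case nf : (null f).
  by rewrite (top_map_null _ nf) comp_zero_r top_map_null //; apply: null_comp; right.
rewrite {2}/top_map; case: excluded_middle_informative => // n'.
case: bool_dec => [nf'|]; last by rewrite nf.
have dt' : deg t <= k - 1 by lia.
pose r := runder_eq_mk (not_truncated_deg hs n') nf'.
pose u : Under (tgt (proj1_sig r)) (k - 1) := MkUnder g dt'.
rewrite (top_map_truncated _ (truncated_under (under_comp u))).
apply: etrans (esym (c r u)) (f_equal (fun m => m ∘ _) _).
by rewrite (proof_irrelevance _ bs (boundary_g hk r)) (proof_irrelevance _ bt (below_g hk u)).
Qed.

Lemma extension_map_id (s : J) (hs : truncated_obj x k s) :
  extension_map hs hs (idm s) = idm (val Yt s).
Proof.
case: (classic (s = x)) => [e|n].
  subst s; rewrite extension_map_top (top_map_truncated _ (truncated_self x (k - 1))).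
  exact: (lift_id Yx (top_obj x k)).
rewrite (extension_map_boundary _ _ (conj hs n) (conj hs n)).
exact: (lift_id Yk (exist _ s (conj hs n))).
Qed.

Lemma extension_map_comp (r s t : J) (hr : truncated_obj x k r) (hs : truncated_obj x k s)
    (ht : truncated_obj x k t) (g : Hom s t) (f : Hom r s) :
  compatible sigma ->
  extension_map hr ht (g ∘ f) = extension_map hs ht g ∘ extension_map hr hs f.
Proof.
move=> c; case: (classic (s = x)) => [e|ns].
  (* A morphism into [x] can only start at [x], and is then the identity. *)
  subst s; case: (classic (r = x)) => [e|nr]; last by case: (boundary_tgt f hr nr hs).
  subst r; rewrite (endo_id f) comp_idr (proof_irrelevance _ hr hs) extension_map_id.
  by rewrite comp_idr.
have bs : boundary_obj x k s by split.
have bt := boundary_tgt g hs ns ht.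
rewrite (extension_map_boundary hs ht bs bt).
case: (classic (r = x)) => [e|nr].
  by subst r; rewrite !extension_map_top; apply: top_map_comp.
rewrite (extension_map_boundary hr ht (conj hr nr) bt).
rewrite (extension_map_boundary hr hs (conj hr nr) bs).
exact: (lift_comp Yk (r := exist _ r (conj hr nr)) (s := exist _ s bs) (t := exist _ t bt)).
Qed.

Lemma extension_map_null (s t : J)
    (hs : truncated_obj x k s) (ht : truncated_obj x k t) (f : Hom s t) :
  null f = true -> extension_map hs ht f = zero_map Z (val Yt s) (val Yt t).
Proof.
move=> nf; case: (classic (s = x)) => [e|ns].
  by subst s; rewrite extension_map_top; apply: top_map_null.
have bs : boundary_obj x k s by split.
rewrite (extension_map_boundary hs ht bs (boundary_tgt f hs ns ht)).
exact: (@Yk_pt (exist _ s bs) (exist _ t (boundary_tgt f hs ns ht)) f nf).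
Qed.

Lemma extension_map_to_ho (Yt_pt : pointed (ho_zero Z) Yt) (s t : J)
    (hs : truncated_obj x k s) (ht : truncated_obj x k t) (f : Hom s t) :
  represents_Yt sigma -> fmap to_ho (extension_map hs ht f) = fmap Yt f.
Proof.
move=> rep; case: (classic (s = x)) => [e|ns]; last first.
  have bs : boundary_obj x k s by split.
  rewrite (extension_map_boundary hs ht bs (boundary_tgt f hs ns ht)).
  exact: (lift_to_ho Yk (s := exist _ s bs) (t := exist _ t (boundary_tgt f hs ns ht)) f).
subst s; rewrite extension_map_top.
(* On null arrows into degree [k], [represents_Yt] says nothing; pointedness of [Yt] applies, as the
   zero maps of [ho M] are the images of those of [M]. *)
case nf : (null f).
  by rewrite (top_map_null _ nf) (Yt_pt _ _ _ nf) /zero_map fmap_comp.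
rewrite /top_map; case: excluded_middle_informative => [h|n].
  exact: (lift_to_ho Yx (s := top_obj x k) (t := exist _ t h) f).
case: bool_dec => [nf'|]; last by rewrite nf.
exact: (rep (runder_eq_mk (not_truncated_deg ht n) nf')).
Qed.

Lemma extension_exists :
  pointed (ho_zero Z) Yt -> compatible sigma -> represents_Yt sigma ->
  exists Y : Lift (restrict Yt (truncated_obj x k)),
    pointed_functor Z Y /\
    restrict_lift (@truncated_boundary J x k) Y = Yk /\
    restrict_lift (truncated_mono (Nat.le_sub_l k 1)) Y = Yx.
Proof.
move=> Yt_pt c rep.
exists (@MkLift M _ (restrict Yt (truncated_obj x k))
  (fun s t f => extension_map (proj2_sig s) (proj2_sig t) f)
  (fun s => extension_map_id (proj2_sig s))
  (fun r s t g f => extension_map_comp (proj2_sig r) (proj2_sig s) (proj2_sig t) g f c)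
  (fun s t f => extension_map_to_ho Yt_pt (proj2_sig s) (proj2_sig t) f rep)).
split; first by move=> s t f nf; apply: extension_map_null.
split; apply: lift_eq => -[s hs] [t ht] f; first exact: extension_map_boundary.
case: (classic (s = x)) => [e|ns].
  subst s; apply: etrans (extension_map_top _ _ _) _.
  apply: etrans (top_map_truncated _ ht _) _.
  by rewrite (proof_irrelevance _ hs (truncated_self x (k - 1))).
have hs' := truncated_mono (Nat.le_sub_l k 1) hs.
have ht' := truncated_mono (Nat.le_sub_l k 1) ht.
apply: etrans (extension_map_boundary _ _ (conj hs' ns) (boundary_tgt f hs' ns ht') f) _.
exact: agree_boundary.
Qed.
End Extension.

(** * The higher homotopy operation *)

Section Obstruction.
Context (M : ModelCategory) (Z : ZeroObject M) (J : PointedWeakLattice).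
Context (Yt : Functor J (ho M)) (Yt_pt : pointed (ho_zero Z) Yt).
Context (Yt_fibrant_cofibrant : forall s : J,
  fibrant Z (val Yt s) /\ cofibrant Z (val Yt s)).
Context (x : J) (k : nat) (hk : k < deg x) (k_gt0 : 0 < k).
Context (Yk : Lift (restrict Yt (boundary_obj x k))) (Yk_pt : pointed_functor Z Yk).
Context (Yk_Reedy : Reedy_fibrant hk Yk_pt).
Context (Yx : Lift (restrict Yt (truncated_obj x (k - 1)))) (Yx_pt : pointed_functor Z Yx).
Context (agree :
  restrict_lift (boundary_mono (Nat.le_sub_l k 1)) Yk =
  restrict_lift (@truncated_boundary J x (k - 1)) Yx).
Context (sigma_k : Hom (val Yt x) (prod_eq Yt x k)) (sigma_k_rep : represents_Yt sigma_k).
Context (fact : PsiFactorization Z hk Yk).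

Local Notation sproj g :=
  (proj (runder_eq_finite x k) (fun r => val Yt (tgt (proj1_sig r))) g).
Local Notation mproj g :=
  (proj (runder_eq_finite x k) (fun r => Mbar Z hk Yk r : M) g).
Local Notation F2_snd := (pb_snd (Psi' fact) (beta Z hk Yk)).
Local Notation zetas := (tuple (runder_eq_finite x k) (zeta hk Yx_pt agree)).
Local Notation gamma_eta := (gamma fact ∘ eta hk Yx_pt agree).

Lemma beta_mono (X : M) (f g : Hom X (prod_Mbar Z hk Yk)) :
  beta Z hk Yk ∘ f = beta Z hk Yk ∘ g -> f = g.
Proof.
move=> e; apply: product_ext => r; apply: forget_mono.
have H (h : Hom X (prod_Mbar Z hk Yk)) :
    forget Z Yk (below_g hk (g := r)) ∘ (mproj r ∘ h) =
    proj (runder_eq_finite x k)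
      (fun r => reduced_product Yk (below_g hk (g := r))) r ∘ (beta Z hk Yk ∘ h).
  rewrite !comp_assoc; congr (_ ∘ _); apply/esym.
  exact: (proj_tuple (runder_eq_finite x k) (fun r => _ ∘ proj _ _ r)).
by rewrite !H e.
Qed.

(** With [q_gamma_eta], this identifies [gamma eta] as the pair [(iota sigma_lt, zeta)]. *)
Lemma F2_snd_gamma_eta : F2_snd ∘ gamma_eta = zetas.
Proof. by rewrite comp_assoc pb_snd_pair; exact: pb_snd_pair. Qed.

Lemma q_gamma_eta : q fact ∘ gamma_eta = iota fact ∘ sigma_lt Yx.
Proof. by rewrite comp_assoc pb_fst_pair -comp_assoc; congr (_ ∘ _); exact: pb_fst_pair. Qed.

Lemma matching_map_fib (g : RUnderEq x k) :
  Fib (matching_map Yk_pt (s := obj_g hk g) (below_g hk (g := g))).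
Proof.
have d : deg (tgt (proj1_sig g)) = S (k - 1) by case: (proj2_sig g) => -> _; lia.
have [_ H] := Yk_Reedy (obj_g hk g).
(* The matching map takes as argument a proof that the targets lie in the boundary; the proof in
   [Reedy_fibrant] is a different term. *)
have -> : @below_g J x k hk g = boundary_below_pred hk (proj2_sig (obj_g hk g)) d.
  exact: proof_irrelevance.
exact: H.
Qed.

Lemma extension_of_vanishes :
  vanishes Yk_pt Yx_pt agree sigma_k fact ->
  exists Y : Lift (restrict Yt (truncated_obj x k)),
    pointed_functor Z Y /\
    restrict_lift (@truncated_boundary J x k) Y = Yk /\
    restrict_lift (truncated_mono (Nat.le_sub_l k 1)) Y = Yx.
Proof.
move=> [_ [theta [[h _] [e _]]]].
have cX := proj2 (Yt_fibrant_cofibrant x).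
have e_snd : F2_snd ∘ theta = alpha hk Yk_pt ∘ sigma_k.
  by apply: beta_mono; rewrite !comp_assoc -pb_square; exact: e.
(* The reversed homotopy starts at [alpha sigma_k], where the lift [sigma_k] is known, and ends at
   [zetas]. *)
have := left_homotopic_comp F2_snd (left_homotopic_sym h).
rewrite F2_snd_gamma_eta e_snd => /(left_homotopic_good cX).
move=> [C [i0 [i1 [p [H [gc [H0 H1]]]]]]].
have wi : Weq i0 := proj1 (weq_retraction (gc_0 gc)) (gc_weq gc).
(* Lifting through [alpha] is done factor by factor, each factor being a matching map. *)
have lift_g (g : RUnderEq x k) : exists L : Hom C (val Yt (tgt (proj1_sig g))),
    L ∘ i0 = sproj g ∘ sigma_k /\
    matching_map Yk_pt (s := obj_g hk g) (below_g hk (g := g)) ∘ L = mproj g ∘ H.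
  apply: (mc_lift (gc_cof0 gc) (matching_map_fib g) (or_introl wi)).
  by rewrite -comp_assoc H0 !comp_assoc proj_alpha.
pose L g := proj1_sig (constructive_indefinite_description _ (lift_g g)).
have LP g := proj2_sig (constructive_indefinite_description _ (lift_g g)).
have pL g : sproj g ∘ tuple (runder_eq_finite x k) L = L g.
  exact: (proj_tuple (runder_eq_finite x k) L).
apply: (@extension_exists _ _ _ _ _ _ hk k_gt0 _ Yk_pt _ Yx_pt agree
  (tuple (runder_eq_finite x k) L ∘ i1) Yt_pt).
  apply/(alpha_zeta hk Yk_pt Yx_pt agree); rewrite -H1; apply: product_ext => g.
  rewrite !comp_assoc proj_alpha -(comp_assoc _ (sproj g)) pL.
  by rewrite (proj2 (LP g)).
(* The new components are homotopic to those of [sigma_k], hence equal to them in the homotopy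
   category. *)
move=> g; rewrite -sigma_k_rep comp_assoc pL -(proj1 (LP g)).
exact/esym/ho_eq_of_homotopic/(good_left_homotopic _ gc).
Qed.

Lemma vanishes_of_extension (Y : Lift (restrict Yt (truncated_obj x k))) :
  restrict_lift (@truncated_boundary J x k) Y = Yk ->
  restrict_lift (truncated_mono (Nat.le_sub_l k 1)) Y = Yx ->
  vanishes Yk_pt Yx_pt agree sigma_k fact.
Proof.
move=> eYk eYx; have cX := proj2 (Yt_fibrant_cofibrant x).
have tr (g : RUnderEq x k) : truncated_obj x k (tgt (proj1_sig g)).
  exact: truncated_under.
pose c (g : RUnderEq x k) : Hom (val Yt x) (val Yt (tgt (proj1_sig g))) :=
  lift_map Y (s := exist _ x (truncated_self x k)) (t := exist _ _ (tr g))
    (arr (proj1_sig g)).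
pose sigma : Hom (val Yt x) (prod_eq Yt x k) := tuple (runder_eq_finite x k) c.
have psigma g : sproj g ∘ sigma = c g by exact: (proj_tuple (runder_eq_finite x k) c).
(* This is functoriality of [Y], which restricts to [Yk] on [s -> v] and to [Yx] on [x -> v]. *)
have sigma_zeta : alpha hk Yk_pt ∘ sigma = zetas.
  apply/alpha_zeta => g u; rewrite psigma.
  have tu : truncated_obj x k (tgt u) by case: (below_g hk u).
  have -> : Yx_at Yx (under_comp u) = lift_map Y
      (s := exist _ x (truncated_self x k)) (t := exist _ _ tu) (arr u ∘ arr (proj1_sig g)).
    by rewrite -eYx; exact: (lift_map_irrelevance Y).
  have -> : lift_map Yk (s := obj_g hk g) (t := exist _ (tgt u) (below_g hk u)) (arr u) =
      lift_map Y (s := exist _ _ (tr g)) (t := exist _ _ tu) (arr u).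
    by rewrite -eYk; exact: (lift_map_irrelevance Y).
  exact/esym/(lift_comp Y (r := exist _ x (truncated_self x k))
    (s := exist _ _ (tr g)) (t := exist _ _ tu)).
have [C [i0 [i1 [p gc]]]] := exists_good_cylinder cX.
have htpy g : exists H : Hom C (val Yt (tgt (proj1_sig g))),
    H ∘ i0 = sproj g ∘ sigma /\ H ∘ i1 = sproj g ∘ sigma_k.
  have fg := proj1 (Yt_fibrant_cofibrant (tgt (proj1_sig g))).
  apply: (right_homotopic_cylinder fg gc); apply: (left_right_homotopic cX).
  apply: (homotopic_of_ho_eq cX fg); rewrite sigma_k_rep psigma.
  exact: (lift_to_ho Y (s := exist _ x (truncated_self x k)) (t := exist _ _ (tr g))).
pose H g := proj1_sig (constructive_indefinite_description _ (htpy g)).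
have HP g := proj2_sig (constructive_indefinite_description _ (htpy g)).
pose Hs : Hom C (prod_eq Yt x k) := tuple (runder_eq_finite x k) H.
have pHs g : sproj g ∘ Hs = H g by exact: (proj_tuple (runder_eq_finite x k) H).
have Hs0 : Hs ∘ i0 = sigma.
  by apply: product_ext => g; rewrite comp_assoc pHs (proj1 (HP g)).
have Hs1 : Hs ∘ i1 = sigma_k.
  by apply: product_ext => g; rewrite comp_assoc pHs (proj2 (HP g)).
have wi : Weq i0 := proj1 (weq_retraction (gc_0 gc)) (gc_weq gc).
(* The square commutes by [eta_comm], since [alpha sigma = zetas]. *)
have [|K [K0 K1]] := mc_lift (gc_cof0 gc) (Psi'_fib fact) (or_introl wi)
  (u := iota fact ∘ sigma_lt Yx) (v := beta Z hk Yk ∘ (alpha hk Yk_pt ∘ Hs)).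
  by rewrite comp_assoc -Psi_factor -!comp_assoc Hs0 sigma_zeta; exact: eta_comm.
pose T : Hom C (F2 fact) := pb_pair K1.
have T0 : T ∘ i0 = gamma_eta.
  apply: pb_ext; first by rewrite q_gamma_eta comp_assoc pb_fst_pair.
  by rewrite F2_snd_gamma_eta comp_assoc pb_snd_pair -comp_assoc Hs0.
have hT : left_homotopic gamma_eta (T ∘ i1).
  by rewrite -T0; apply: good_left_homotopic gc.
split; first by exists gamma_eta.
(* The far end of [T] serves as [theta]: its component in [prod_Mbar] is [alpha sigma_k], and
   [q theta] is homotopic to [q gamma eta = iota sigma_lt]. *)
exists (T ∘ i1); split; first by split=> //; apply: left_right_homotopic cX hT.
split.
  rewrite -!comp_assoc (comp_assoc _ T) pb_fst_pair comp_assoc K1.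
  by rewrite -!comp_assoc Hs1.
have hq : left_homotopic (q fact ∘ (T ∘ i1)) (iota fact ∘ sigma_lt Yx).
  by rewrite -q_gamma_eta; apply/left_homotopic_comp/left_homotopic_sym.
by split=> //; apply: left_right_homotopic cX hq.
Qed.
End Obstruction.

Theorem proposition6p10
  (E : ModelCategory)
  (J : PointedWeakLattice)
  (Yt : Functor J (ho (Pointed E)))
  (Yt_pointed : pointed (ho_zero (Pointed_zero E)) Yt)
  (Yt_fibrant_cofibrant : forall s : J,
     fibrant (Pointed_zero E) (val Yt s) /\ cofibrant (Pointed_zero E) (val Yt s))
  (x : J) (n k : nat) (n_lt_x : n < deg x) (k_le_n : k <= n) (two_le_k : 2 <= k)
  (Yk : Lift (restrict Yt (boundary_obj x k)))
  (Yk_pointed : pointed_functor (Pointed_zero E) Yk)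
  (Yk_Reedy : Reedy_fibrant (PeanoNat.Nat.le_lt_trans k n (deg x) k_le_n n_lt_x) Yk_pointed)
  (Yx : Lift (restrict Yt (truncated_obj x (k - 1))))
  (Yx_pointed : pointed_functor (Pointed_zero E) Yx)
  (Yk_Yx_agree :
     restrict_lift (boundary_mono (PeanoNat.Nat.le_sub_l k 1)) Yk =
     restrict_lift (@truncated_boundary J x (k - 1)) Yx)
  (sigma_k : Hom (val Yt x) (prod_eq Yt x k))
  (sigma_k_represents : represents_Yt sigma_k)
  (fact : PsiFactorization (Pointed_zero E) (PeanoNat.Nat.le_lt_trans k n (deg x) k_le_n n_lt_x) Yk) :
  (exists Y : Lift (restrict Yt (truncated_obj x k)),
     pointed_functor (Pointed_zero E) Y /\
     restrict_lift (@truncated_boundary J x k) Y = Yk /\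
     restrict_lift (truncated_mono (PeanoNat.Nat.le_sub_l k 1)) Y = Yx) <->
  vanishes Yk_pointed Yx_pointed Yk_Yx_agree sigma_k fact.
Proof.
(* Subtraction being truncated, [deg t <= k - 1] means [deg t < k] for positive [k]. *)
have k_gt0 : 0 < k by lia.
split=> [[Y [_ [eYk eYx]]]|v].
  exact: (vanishes_of_extension Yt_fibrant_cofibrant Yk_pointed Yx_pointed
    Yk_Yx_agree sigma_k_represents fact eYk eYx).
exact: (extension_of_vanishes Yt_pointed Yt_fibrant_cofibrant k_gt0 Yk_Reedy
  sigma_k_represents v).
Qed.
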